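(* Let $\Gamma$ be a finitely generated amenable group and let $E$ be a finite nonempty set. Let $r\in I\mapsto p(r)$ be a continuous family of Markov transition kernels on $X=\Gamma\times E$, where $I\subset\mathbb R$ is an interval. Let $S$ be a finite symmetric generating set of $\Gamma$ and let $\mu_S$ be the uniform probability measure on $S$. Assume that the family is $\Gamma$-invariant, strongly reversible and uniformly irreducible (with respect to $S$). Then there is a continuous function $r\in I\mapsto\epsilon(r)\in(0,1/2)$ such that for every $n$ and every $r\in I$, $$\frac{1}{|E|}\sum_{i\in E}p^{(2n+2)}_{r;i,i}(e,e)\leq 2(1-\epsilon(r))^{2n}+\frac{2}{|E|}\mu_S^{(2\lfloor \epsilon(r)n\rfloor)}(e).$$ Moreover, assuming in addition that $r\mapsto p(r)$ has continuous second moment, there exists a continuous function $r\in I\mapsto\epsilon'(r)\in(0,1/2)$ such that for every $n$ and every $r\in I$, $$\frac{1}{|E|}\mu_S^{(2n+2)}(e)\leq 2(1-\epsilon'(r))^{2n}+\frac{2}{|E|}\sum_{i\in E}p^{(2\lfloor \epsilon'(r)n\rfloor)}_{r;i,i}(e,e).$$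
   Context: Elements of $X=\Gamma\times E$ are written $(x,i)$. A Markov transition kernel on $X$ is a map $p:X\times X\to[0,\infty)$ with $\sum_{b\in X}p(a,b)=1$ for all $a\in X$; $p^{(n)}$ is its $n$th convolution power ($p^{(0)}$ the identity kernel, $p^{(n+1)}(a,b)=\sum_c p^{(n)}(a,c)p(c,b)$). $\mu_S^{(n)}$ is the $n$th convolution power of $\mu_S$. A continuous family of Markov transition kernels on $X$ is a map $r\in I\mapsto p(r)$, each $p(r)$ a Markov transition kernel, such that $r\mapsto p_{r;i,j}(x,y):=p(r)((x,i),(y,j))$ is continuous for all $(x,i),(y,j)$; $p^{(n)}_{r;i,j}(x,y):=p^{(n)}(r)((x,i),(y,j))$. It is: - $\Gamma$-invariant if $p_{r;i,j}(gx,gy)=p_{r;i,j}(x,y)$ for all $r$, $g\in\Gamma$, $(x,i),(y,j)\in X$; - strongly reversible if there are functions $m(r):X\to\mathbb R_+$, written $m_{r;i}(x)=m(r)((x,i))$, continuous in $r$ for each $(x,i)$, with $m_{r;i}(x)p_{r;i,j}(x,y)=p_{r;j,i}(y,x)m_{r;j}(y)$ for all $r,(x,i),(y,j)$, and continuous positive functions $c,C$ on $I$ with $c(r)\le m_{r;i}(x)\le C(r)$ for all $r,(x,i)$; - uniformly irreducible (with respect to $S$) if there exist an integer $K$ and a continuous positive function $r\mapsto\varepsilon_*(r)$ such that $p^{(K)}_{r;i,j}(x,y)\ge\varepsilon_*(r)$ for all $r$, all $i,j\in E$ and all $x,y\in\Gamma$ with $x^{-1}y\in S$; - of continuous second moment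 (with respect to $S$; for a $\Gamma$-invariant family) if $\mathcal M_2(r)=\sum_{i,j\in E}\sum_{x\in\Gamma}d(e,x)^2p_{r;i,j}(e,x)$ is finite for every $r$ and continuous in $r$, where $d$ is the word distance of $S$. *)

(* Defs.v *)
From HB Require Import structures.
From mathcomp Require Import all_boot all_order all_algebra finmap.
From mathcomp Require Import all_classical all_reals all_analysis.

Set Implicit Arguments.
Unset Strict Implicit.
Unset Printing Implicit Defensive.

Import Order.TTheory GRing.Theory Num.Theory.
Import numFieldNormedType.Exports.

Local Open Scope classical_set_scope.
Local Open Scope ring_scope.

(* Amenability of a discrete group: a left-invariant finitely additive
   probability measure defined on all subsets. *)
Definition amenable (R : realType) (G : groupType) : Prop :=
  exists nu : set G -> R,
    [/\ forall A, 0 <= nu A,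
        nu setT = 1,
        forall A B, A `&` B = set0 -> nu (A `|` B) = nu A + nu B
      & forall g A, nu [set (g * x)%g | x in A] = nu A].

Definition symmetric_fset (G : groupType) (S : {fset G}) : Prop :=
  forall x, x \in S -> (x^-1)%g \in S.

(* The only subgroup containing S is the whole group. *)
Definition generates (G : groupType) (S : {fset G}) : Prop :=
  forall H : {pred G}, group_closed H -> {subset S <= H} -> forall x, x \in H.

(* Least length of a word in S leading from x to y. *)
Definition word_dist (R : realType) (G : groupType) (S : {fset G})
    (x y : G) : R :=
  inf [set (size w)%:R | w in
        [set w : seq G | {subset w <= S} /\ (x * \prod_(s <- w) s)%g = y]].

Definition unif_prob (R : realType) (G : groupType) (S : {fset G}) (x : G) : R :=
  (x \in S)%:R / #|` S|%:R.

(* Sums over infinite sets of nonnegative terms are computed in \bar R by \esum;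
   [fine] maps an infinite sum to 0, which does not occur for probability
   measures and Markov kernels. *)
Definition convolution (R : realType) (G : groupType) (f g : G -> R) (x : G) : R :=
  fine (\esum_(y in [set: G]) (f y * g (y^-1 * x)%g)%:E).

Fixpoint conv_pow (R : realType) (G : groupType) (mu : G -> R) (n : nat) : G -> R :=
  if n is k.+1 then convolution (conv_pow mu k) mu else fun x => (x == 1%g)%:R.

Definition markov_kernel (R : realType) (X : choiceType) (p : X -> X -> R) : Prop :=
  (forall a b, 0 <= p a b) /\
  (forall a, \esum_(b in [set: X]) (p a b)%:E = 1%E).

Fixpoint kernel_pow (R : realType) (X : choiceType) (p : X -> X -> R) (n : nat) :
    X -> X -> R :=
  if n is k.+1 then
    fun a b => fine (\esum_(c in [set: X]) (kernel_pow p k a c * p c b)%:E)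
  else fun a b => (a == b)%:R.

(* Families indexed by an interval I are given by functions on R, of which only
   the values on I matter; continuity is for the subspace topology of I. *)
Definition continuous_kernel_family (R : realType) (X : choiceType)
    (I : set R) (p : R -> X -> X -> R) : Prop :=
  (forall r, I r -> markov_kernel (p r)) /\
  (forall a b, {within I, continuous (fun r => p r a b)}).

Definition invariant_family (R : realType) (G : groupType) (E : finType)
    (I : set R) (p : R -> G * E -> G * E -> R) : Prop :=
  forall r, I r -> forall (g x y : G) (i j : E),
    p r ((g * x)%g, i) ((g * y)%g, j) = p r (x, i) (y, j).

Definition strongly_reversible (R : realType) (X : choiceType)
    (I : set R) (p : R -> X -> X -> R) : Prop :=
  exists m : R -> X -> R,
    [/\ forall r, I r -> forall a, 0 <= m r a,
        forall a, {within I, continuous (fun r => m r a)},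
        forall r, I r -> forall a b, m r a * p r a b = p r b a * m r b
      & exists c C : R -> R,
          [/\ {within I, continuous c}, {within I, continuous C},
              forall r, I r -> 0 < c r /\ 0 < C r
            & forall r, I r -> forall a, c r <= m r a <= C r]].

Definition uniformly_irreducible (R : realType) (G : groupType) (E : finType)
    (S : {fset G}) (I : set R) (p : R -> G * E -> G * E -> R) : Prop :=
  exists (K : nat) (eps : R -> R),
    [/\ {within I, continuous eps},
        forall r, I r -> 0 < eps r
      & forall r, I r -> forall (i j : E) (x y : G), (x^-1 * y)%g \in S ->
          eps r <= kernel_pow (p r) K (x, i) (y, j)].

Definition second_moment (R : realType) (G : groupType) (E : finType)
    (S : {fset G}) (p : G * E -> G * E -> R) : \bar R :=
  (\sum_(i : E) \sum_(j : E)
     \esum_(x in [set: G]) (word_dist R S 1%g x ^+ 2 * p (1%g, i) (x, j))%:E)%E.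

Definition continuous_second_moment (R : realType) (G : groupType) (E : finType)
    (S : {fset G}) (I : set R) (p : R -> G * E -> G * E -> R) : Prop :=
  (forall r, I r -> second_moment S (p r) \is a fin_num) /\
  {within I, continuous (fun r => fine (second_moment S (p r)))}.

(* Main.v *)
(* For kernels on G * E commuting with left translations by G, [tau], the sum of
   the diagonal entries over one fibre, is a positive trace, and reversibility
   makes the kernels self-adjoint for a G-invariant weight m. This trace on the
   convolution semiring of nonnegative invariant kernels replaces the spectral
   theorem.

   Monotonicity. Let X = A^2 and Y be reversible with tau (C X C) <= tau (C Y C)
   for the powers C of A. Put b_i = tau (X^(N - 2^i) Y^(2^i)) with N = 2^k. Then
   tau (X^N) <= b_0 and, by Cauchy-Schwarz, 2 b_i <= tau (X^N) + b_(i+1), hence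
   tau (X^N) <= b_0 <= ... <= b_k = tau (Y^N).

   Let B be the kernel doing a step of mu_S in G and resampling the coordinate
   in E from the normalized m, so that tau (B^n) = mu_S^(n)(e) for n > 0.
   Irreducibility gives I - P^2 >= d (I - B^2), and the second moment gives
   I - B >= d (I - P), as quadratic forms. One applies monotonicity to
   Y = (1 - d) I + d B^2 and X = P^2, and to Y = (1 - d/2) I + (d/2) P and
   X = ((I + B) / 2)^2 respectively, and concludes with a Chernoff bound for the
   binomial expansion of Y^N. The lazy kernel (I + B) / 2 is needed because B
   may be periodic; tau (B^(2n+2)) <= 2 tau (((I + B) / 2)^(2N)) for N <= n + 1
   since even times have mass 1/2 in the binomial law. *)
Require Import Defs.
From HB Require Import structures.
From mathcomp Require Import all_boot all_order all_algebra finmap.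
From mathcomp Require Import all_classical all_reals all_analysis.
From mathcomp Require Import ring lra zify.

Import Order.TTheory GRing.Theory Num.Theory.
Import numFieldNormedType.Exports.

Local Open Scope classical_set_scope.
Local Open Scope ring_scope.

Set Implicit Arguments.
Unset Strict Implicit.
Unset Printing Implicit Defensive.

(** * Elementary inequalities *)

Section Numeric.
Context {R : realType}.

Lemma bernoulli_ineq (x : R) n : 0 <= x -> 1 + n%:R * x <= (1 + x) ^+ n.
Proof.
move=> x0; elim: n => [|n IHn]; first by rewrite mul0r addr0 expr0.
have h1 : (1 + x) * (1 + n%:R * x) <= (1 + x) * (1 + x) ^+ n.
  by rewrite ler_wpM2l// addr_ge0.
have h2 : 0 <= n%:R * (x * x) by rewrite mulr_ge0// mulr_ge0.
by rewrite exprS -natr1; lra.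
Qed.

(** With $e = d/48$ and $t = \lfloor 1/(4e) \rfloor$, Bernoulli gives $2 \le (1+8e)^t$, and $tq \le
    n/2 \le N$, so $2^q \le (1+8e)^N$. What remains is $(1+8e)(1-24e) \le 1-4e \le (1-e)^4$ together
    with $4N \ge 2n$. *)
Lemma two_exp_decay (d : R) (n N q : nat) : 0 < d -> d <= 1 ->
  (n < 2 * N)%N -> q%:R <= 2 * (d / 48) * n%:R ->
  2 ^+ q * (1 - d / 2) ^+ N <= (1 - d / 48) ^+ (2 * n).
Proof.
move=> d0 d1 nN qn; set e := d / 48.
have de : d = 48 * e by rewrite /e; field.
have e0 : 0 < e by rewrite divr_gt0.
have e1 : e <= 48^-1 by rewrite /e ler_piMl// invr_ge0.
pose t := Num.truncn (4 * e)^-1.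
have te : t%:R <= (4 * e)^-1 by rewrite truncn_le// invr_ge0 mulr_ge0// ltW.
have et : (4 * e)^-1 < t.+1%:R := truncnS_gt _.
have tqN : (t * q <= N)%N.
  rewrite -(ler_nat R) natrM.
  apply: (@le_trans _ _ ((4 * e)^-1 * (2 * e * n%:R))).
    by apply: ler_pM.
  have -> : (4 * e)^-1 * (2 * e * n%:R) = n%:R / 2 by field; rewrite gt_eqF.
  by rewrite ler_pdivrMr// -natrM ler_nat mulnC ltnW.
have h2 : 2 <= (1 + 8 * e) ^+ t.
  apply: le_trans (bernoulli_ineq t _); last by rewrite mulr_ge0// ltW.
  have : (4 * e)^-1 * (8 * e) < t.+1%:R * (8 * e).
    by rewrite ltr_pM2r// mulr_gt0.
  have -> : (4 * e)^-1 * (8 * e) = 2 by field; rewrite gt_eqF.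
  by rewrite -natr1; lra.
have b1 : 1 <= 1 + 8 * e by rewrite lerDl mulr_ge0// ltW.
have b0 : 0 <= 1 - d / 2 by lra.
have h3 : 2 ^+ q <= (1 + 8 * e) ^+ N.
  apply: (@le_trans _ _ ((1 + 8 * e) ^+ (t * q))).
    by rewrite exprM lerXn2r// nnegrE ?exprn_ge0// (le_trans _ b1).
  exact: ler_weXn2l.
apply: (@le_trans _ _ (((1 + 8 * e) * (1 - d / 2)) ^+ N)).
  by rewrite exprMn ler_wpM2r// exprn_ge0.
apply: (@le_trans _ _ (((1 - e) ^+ 4) ^+ N)).
  have e4 : 1 - 4 * e <= (1 - e) ^+ 4.
    have -> : (1 - e) ^+ 4 = 1 - 4 * e + e ^+ 2 * (6 - 4 * e + e ^+ 2) by ring.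
    have : 0 <= e ^+ 2 * (6 - 4 * e + e ^+ 2).
      by rewrite mulr_ge0 ?sqr_ge0//; have := sqr_ge0 e; lra.
    lra.
  rewrite lerXn2r// ?nnegrE.
  - by rewrite mulr_ge0// (le_trans _ b1).
  - by rewrite exprn_ge0//; lra.
  - apply: le_trans e4; rewrite de.
    have := mulr_ge0 (ltW e0) (ltW e0); nra.
rewrite -exprM; apply: ler_wiXn2l.
- by lra.
- by lra.
- by rewrite -[4%N]/(2 * 2)%N -mulnA leq_mul2l ltnW.
Qed.

(** The decrements of a convex sequence do not increase, so each is at most the first. *)
Lemma convex_seq_le (c : nat -> R) :
  (forall j, 2 * c j.+1 <= c j + c j.+2) ->
  forall K, c 0%N - c K <= K%:R * (c 0%N - c 1%N).
Proof.
move=> cc; have step j : c j - c j.+1 <= c 0%N - c 1%N.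
  by elim: j => // j IHj; have := cc j; lra.
elim=> [|K IHK]; first by rewrite subrr mul0r.
by have := step K; rewrite -natr1 mulrDl mul1r; lra.
Qed.

Lemma midpoint_seq_ge (x : R) (b : nat -> R) (k : nat) :
  (forall i, (i < k)%N -> 2 * b i <= x + b i.+1) -> x <= b 0%N -> x <= b k.
Proof.
move=> bS b0; suff : forall i, (i <= k)%N -> x <= b i by apply.
elim=> [//|i IHi] ik.
by have := bS i ik; have := IHi (ltnW ik); lra.
Qed.

(** Monotonicity of traces is obtained by repeated doubling, hence at exponents that are powers of
    2. Such an exponent within a factor 2 of $n$ costs only a constant in the exponential rate. *)
Lemma pow2_between n : exists k, (2 ^ k <= n.+1)%N /\ (n < 2 * 2 ^ k)%N.
Proof.
exists (trunc_log 2 n.+1).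
have /andP[h1 h2] := @trunc_log_bounds 2 n.+1 isT isT.
by split => //; rewrite -expnS; exact: ltnW.
Qed.

End Numeric.

(** * Sums of nonnegative families *)

Section Esum.
Context {R : realType}.
Local Open Scope ereal_scope.

Lemma esum_ub1 (T : choiceType) (f : T -> \bar R) (t : T) :
  (forall x, 0 <= f x) -> f t <= \esum_(x in [set: T]) f x.
Proof.
move=> f0; apply: esum_ge; exists [set t]; last by rewrite fsbig_set1.
by split.
Qed.

(** One inequality is distributivity over finite sums. For finite $c > 0$ the other is the same
    inequality for $c^{-1}$; the cases $c = 0$ and $c = +\infty$ are treated apart. *)
Lemma ge0_esumZl (T : choiceType) (c : \bar R) (f : T -> \bar R) :
  0 <= c -> (forall x, 0 <= f x) ->
  \esum_(x in [set: T]) (c * f x) = c * \esum_(x in [set: T]) f x.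
Proof.
move=> c0 f0.
have le_dir (d : \bar R) (g : T -> \bar R) : 0 <= d -> (forall x, 0 <= g x) ->
    \esum_(x in [set: T]) (d * g x) <= d * \esum_(x in [set: T]) g x.
  move=> d0 g0; apply: ge_ereal_sup => _ [X [finX _] <-].
  rewrite -ge0_mule_fsumr//; apply: lee_wpmul2l => //.
  by apply: ereal_sup_ubound; exists X.
apply/eqP; rewrite eq_le le_dir//=.
case: c c0 => [c| |]//; last first.
  move=> _.
  have [f_eq0|] := pselect (forall x, f x = 0).
    by rewrite !esum1 ?mule0// => x _; rewrite f_eq0 mule0.
  move=> /existsNP[x /eqP fx].
  have fx0 : 0 < f x by rewrite lt0e fx f0.
  suff -> : \esum_(x in [set: T]) (+oo * f x) = +oo by rewrite leey.
  apply/eqP; rewrite -leye_eq.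
  apply: le_trans (@esum_ub1 _ (fun x => +oo * f x) x _); last first.
    by move=> y; rewrite mule_ge0.
  by rewrite gt0_mulye.
rewrite lee_fin [in X in X -> _]le_eqVlt => /orP [/eqP <-|c0].
  by rewrite mul0e esum_ge0// => x _; rewrite mul0e.
have -> : \esum_(x in [set: T]) f x =
    \esum_(x in [set: T]) (c^-1%:E * (c%:E * f x)).
  by apply: eq_esum => x _; rewrite muleA -EFinM mulVf ?gt_eqF// mul1e.
rewrite -[leRHS]mul1e -(@mulfV _ c) ?gt_eqF// EFinM -muleA.
apply: lee_wpmul2l; first by rewrite lee_fin ltW.
apply: le_dir; first by rewrite lee_fin invr_ge0 ltW.
by move=> x; rewrite mule_ge0// lee_fin ltW.
Qed.

Lemma ge0_esumZr (T : choiceType) (c : \bar R) (f : T -> \bar R) :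
  0 <= c -> (forall x, 0 <= f x) ->
  \esum_(x in [set: T]) (f x * c) = (\esum_(x in [set: T]) f x) * c.
Proof.
move=> c0 f0; rewrite muleC -ge0_esumZl//.
by apply: eq_esum => x _; rewrite muleC.
Qed.

Lemma reindex_esumT (T T' : choiceType) (e : T -> T') (f : T' -> \bar R) :
  bijective e -> \esum_(y in [set: T']) f y = \esum_(x in [set: T]) f (e x).
Proof.
by rewrite -setTT_bijective; exact: reindex_esum.
Qed.

Lemma exchange_esum (T T' : choiceType) (f : T -> T' -> \bar R) :
  (forall x y, 0 <= f x y) ->
  \esum_(x in [set: T]) \esum_(y in [set: T']) f x y =
  \esum_(y in [set: T']) \esum_(x in [set: T]) f x y.
Proof.
move=> f0; rewrite !esum_esum//.
rewrite (@reindex_esum _ _ _ ([set: T'] `*`` fun=> [set: T])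
  ([set: T] `*`` fun=> [set: T']) (fun k => (k.2, k.1)))//.
split => //=.
- by move=> [a b] [c d] _ _ /= [-> ->].
- by move=> [a b] _; exists (b, a).
Qed.

Lemma esum_pick (T : choiceType) (c0 : T) (f : T -> \bar R) : (forall c, 0 <= f c) ->
  (forall c, c != c0 -> f c = 0) -> \esum_(c in [set: T]) f c = f c0.
Proof.
move=> f0 fc; rewrite (esumID [set c0])//.
rewrite [X in _ + X]esum1 ?adde0; last first.
  by move=> c [_ /= /eqP]; exact: fc.
by rewrite setTI esum_set1.
Qed.

Lemma esum_pair (T T' : choiceType) (f : T * T' -> \bar R) :
  (forall x, 0 <= f x) ->
  \esum_(k in [set: (T * T')%type]) f k =
  \esum_(x in [set: T]) \esum_(y in [set: T']) f (x, y).
Proof.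
move=> f0; rewrite esum_esum//.
rewrite (_ : [set: T] `*`` (fun=> [set: T']) = setT) ?eqEsubset//.
by apply: eq_esum => -[].
Qed.

Lemma esum_fin (E : finType) (f : E -> \bar R) : (forall x, 0 <= f x) ->
  \esum_(i in [set: E]) f i = \sum_i f i.
Proof.
move=> f0.
have finE : finite_set [set: E] by exact: finite_finset.
rewrite esum_fset// fsbig_finite//= (perm_big (index_enum E))//=.
apply: uniq_perm; rewrite ?index_enum_uniq ?fset_uniq//.
by move=> x; rewrite in_fset_set// mem_index_enum in_setT.
Qed.

End Esum.

(** * The convolution semiring of invariant kernels *)

Section GroupEsum.
Context {R : realType} {G : groupType} {E : finType}.
Local Open Scope ereal_scope.

Lemma esum_mulg (g : G) (f : G * E -> \bar R) :
  \esum_(c in [set: G * E]) f c = \esum_(c in [set: G * E]) f ((g * c.1)%g, c.2).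
Proof.
apply: (@reindex_esumT _ _ _ (fun c : G * E => ((g * c.1)%g, c.2))).
exists (fun c => ((g^-1 * c.1)%g, c.2)) => -[x i] /=.
  by rewrite mulKg.
by rewrite mulVKg.
Qed.

Lemma esum_GE (f : G * E -> \bar R) : (forall x, 0 <= f x) ->
  \esum_(c in [set: G * E]) f c =
  \sum_(k : E) \esum_(x in [set: G]) f (x, k).
Proof.
move=> f0; rewrite esum_pair// exchange_esum// esum_fin// => k.
by apply: esum_ge0.
Qed.

End GroupEsum.

(* The value of a G-invariant kernel on G * E at ((x, i), (y, j)) is stored at
   [x^-1 * y], [i], [j]. *)
Record nker (R : realType) (G : groupType) (E : finType) := Nker {
  nval :> G -> E -> E -> \bar R;
  nval_ge0 : forall x i j, (0 <= nval x i j)%E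
}.

Arguments Nker {R G E}.

#[global] Hint Extern 0 (is_true (_ <= nval _ _ _ _)%O) => apply: nval_ge0 : core.

HB.instance Definition _ (R : realType) (G : groupType) (E : finType) :=
  gen_eqMixin (nker R G E).
HB.instance Definition _ (R : realType) (G : groupType) (E : finType) :=
  gen_choiceMixin (nker R G E).

Section NkerSemiRing.
Context {R : realType} {G : groupType} {E : finType}.
Implicit Types X Y Z : nker R G E.
Local Open Scope ereal_scope.

Lemma nkerP X Y : (forall x i j, X x i j = Y x i j) -> X = Y.
Proof.
case: X Y => [f f0] [g g0] /= fg.
have {}fg : f = g by do 3![apply/funext => ?]; exact: fg.
by subst g; congr Nker; exact: Prop_irrelevance.
Qed.

Definition nzero : nker R G E := Nker (fun _ _ _ => 0) (fun _ _ _ => lexx _).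

Definition nadd X Y : nker R G E :=
  Nker (fun x i j => X x i j + Y x i j)
    (fun x i j => adde_ge0 (nval_ge0 X x i j) (nval_ge0 Y x i j)).

Definition none : nker R G E :=
  Nker (fun x i j => (((x == 1%g) && (i == j))%:R : R)%:E)
    (fun x i j => ler0n _ _).

Lemma nmul_ge0 X Y x i j :
  0 <= \esum_(c in [set: G * E]) (X c.1 i c.2 * Y (c.1^-1 * x)%g c.2 j).
Proof. by apply: esum_ge0 => c _; exact: mule_ge0. Qed.

Definition nmul X Y : nker R G E := Nker _ (nmul_ge0 X Y).

(** Tonelli, after left translation by $c$ in the inner sum. Entries in $[0,+\infty]$ make every
    product defined, with no summability condition. *)
Lemma nmulA : associative nmul.
Proof.
move=> X Y Z; apply: nkerP => x i j /=.
transitivity (\esum_(c in [set: G * E]) \esum_(d in [set: G * E])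
    (X c.1 i c.2 * (Y d.1 c.2 d.2 * Z (d.1^-1 * (c.1^-1 * x))%g d.2 j))).
  apply: eq_esum => c _; rewrite ge0_esumZl// => d; exact: mule_ge0.
transitivity (\esum_(d in [set: G * E]) \esum_(c in [set: G * E])
    (X c.1 i c.2 * Y (c.1^-1 * d.1)%g c.2 d.2 * Z (d.1^-1 * x)%g d.2 j)).
  rewrite [RHS]exchange_esum; last by move=> ? ?; rewrite !mule_ge0.
  apply: eq_esum => c _; rewrite [RHS](esum_mulg c.1).
  by apply: eq_esum => d _ /=; rewrite mulKg invgM mulgA muleA.
by apply: eq_esum => d _; rewrite ge0_esumZr// => c; exact: mule_ge0.
Qed.

Lemma nmul1 : left_id none nmul.
Proof.
move=> X; apply: nkerP => x i j /=.
rewrite (@esum_pick _ _ (1%g, i)) /=.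
- by rewrite !eqxx invg1 mul1g mul1e.
- by move=> c; apply: mule_ge0 => //; rewrite lee_fin ler0n.
- move=> [y k]; rewrite xpair_eqE (eq_sym k) => /negbTE /= ->.
  by rewrite mul0e.
Qed.

Lemma nmulr1 : right_id none nmul.
Proof.
move=> X; apply: nkerP => x i j /=.
rewrite (@esum_pick _ _ (x, j)) /=.
- by rewrite mulVg !eqxx mule1.
- by move=> c; apply: mule_ge0 => //; rewrite lee_fin ler0n.
- move=> [y k] /=; rewrite xpair_eqE => yk.
  suff -> : (y^-1 * x == 1)%g = (y == x) by rewrite (negbTE yk) mule0.
  by rewrite mulg_eq1 (can_eq invgK).
Qed.

Lemma naddA : associative nadd.
Proof. by move=> X Y Z; apply: nkerP => x i j /=; rewrite addeA. Qed.
Lemma naddC : commutative nadd.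
Proof. by move=> X Y; apply: nkerP => x i j /=; rewrite addeC. Qed.
Lemma nadd0 : left_id nzero nadd.
Proof. by move=> X; apply: nkerP => x i j /=; rewrite add0e. Qed.

Lemma nmulDl : left_distributive nmul nadd.
Proof.
move=> X Y Z; apply: nkerP => x i j /=.
rewrite -esumD; [|by move=> *; exact: mule_ge0..].
by apply: eq_esum => c _; exact: ge0_muleDl.
Qed.

Lemma nmulDr : right_distributive nmul nadd.
Proof.
move=> X Y Z; apply: nkerP => x i j /=.
rewrite -esumD; [|by move=> *; exact: mule_ge0..].
by apply: eq_esum => c _; exact: ge0_muleDr.
Qed.

Lemma nmul0 : left_zero nzero nmul.
Proof.
by move=> X; apply: nkerP => x i j /=; rewrite esum1// => c _; rewrite mul0e.
Qed.

Lemma nmulr0 : right_zero nzero nmul.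
Proof.
by move=> X; apply: nkerP => x i j /=; rewrite esum1// => c _; rewrite mule0.
Qed.

End NkerSemiRing.

HB.instance Definition _ (R : realType) (G : groupType) (E : finType) :=
  GRing.isPzSemiRing.Build (nker R G E) naddA naddC nadd0
    nmulA nmul1 nmulr1 nmulDl nmulDr nmul0 nmulr0.

(** * Trace and stochastic kernels *)

Section NkerTrace.
Context {R : realType} {G : groupType} {E : finType}.
Implicit Types X Y Z U V : nker R G E.
Local Open Scope ereal_scope.

Lemma nmulE X Y x i j : (X * Y)%R x i j =
  \esum_(c in [set: G * E]) (X c.1 i c.2 * Y (c.1^-1 * x)%g c.2 j).
Proof. by []. Qed.

Lemma naddE X Y x i j : (X + Y)%R x i j = X x i j + Y x i j.
Proof. by []. Qed.

Lemma noneE x i j :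
  (1%R : nker R G E) x i j = (((x == 1%g) && (i == j))%:R : R)%:E.
Proof. by []. Qed.

Lemma nscal_ge0 (c : R) x i j : 0 <= `|c|%:E * (1%R : nker R G E) x i j.
Proof. by apply: mule_ge0 => //; rewrite lee_fin. Qed.

(* The absolute value keeps the entries nonnegative; only c >= 0 is used. *)
Definition nscal (c : R) : nker R G E := Nker _ (nscal_ge0 c).

Lemma nscalE (c : R) X x i j : (0 <= c)%R ->
  (nscal c * X)%R x i j = c%:E * X x i j.
Proof.
move=> c0; rewrite nmulE -[X in RHS]mul1r nmulE -ge0_esumZl//; last first.
  by move=> d; exact: mule_ge0.
by apply: eq_esum => d _; rewrite muleA /= ger0_norm.
Qed.

Lemma nscalC (c : R) X : (nscal c * X = X * nscal c)%R.
Proof.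
rewrite -[X in LHS]mul1r -[X in RHS]mulr1; apply: nkerP => x i j.
rewrite mulrA nmulE.
transitivity (`|c|%:E * X x i j).
  rewrite -[X in RHS]mul1r nmulE -ge0_esumZl//; last first.
    by move=> d; exact: mule_ge0.
  by apply: eq_esum => d _; rewrite muleA mulr1.
rewrite -mulrA mul1r -[X in LHS]mulr1 !nmulE -ge0_esumZl//; last first.
  by move=> d; exact: mule_ge0.
by apply: eq_esum => d _ /=; rewrite muleCA.
Qed.

Definition tau X : \bar R := \sum_(i : E) X 1%g i i.

Lemma tau_ge0 X : 0 <= tau X.
Proof. by apply: sume_ge0 => i _. Qed.

Lemma tauD X Y : tau (X + Y)%R = tau X + tau Y.
Proof. by rewrite /tau -big_split. Qed.

Lemma tauZ (c : R) X : (0 <= c)%R -> tau (nscal c * X)%R = c%:E * tau X.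
Proof.
move=> c0; rewrite /tau ge0_sume_distrr//.
by apply: eq_bigr => i _; rewrite nscalE.
Qed.

(** The trace is a sum over two indices in $E$ and one element of $G$; exchanging the indices and
    substituting $x^{-1}$ for $x$ swaps the factors. *)
Lemma tauC X Y : tau (X * Y)%R = tau (Y * X)%R.
Proof.
have tauE U V : tau (U * V)%R = \sum_(i : E) \sum_(k : E)
    \esum_(x in [set: G]) (U x i k * V (x^-1)%g k i).
  apply: eq_bigr => i _; rewrite nmulE esum_GE/=; last first.
    by move=> c; exact: mule_ge0.
  by apply: eq_bigr => k _; apply: eq_esum => x _; rewrite mulg1.
rewrite !tauE exchange_big/=; apply: eq_bigr => k _; apply: eq_bigr => i _.
rewrite (@reindex_esumT _ _ _ (fun x : G => (x^-1)%g)); last first.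
  by exists (fun x => (x^-1)%g); exact: invgK.
by apply: eq_esum => x _; rewrite invgK muleC.
Qed.

Definition stochastic X := forall i, \esum_(c in [set: G * E]) X c.1 i c.2 = 1.

Lemma stochastic1 : stochastic 1%R.
Proof.
move=> i; rewrite (@esum_pick _ _ (1%g, i)) //=; first by rewrite !eqxx.
by move=> [x j]; rewrite xpair_eqE (eq_sym i) => /negbTE /= ->.
Qed.

Lemma stochasticM X Y : stochastic X -> stochastic Y -> stochastic (X * Y)%R.
Proof.
move=> mX mY i; under eq_esum => c _ do rewrite nmulE.
rewrite exchange_esum; last by move=> *; exact: mule_ge0.
rewrite -[RHS](mX i); apply: eq_esum => d _.
rewrite ge0_esumZl// (esum_mulg d.1)/=.
under eq_esum => c _ do rewrite mulKg.
by rewrite mY mule1.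
Qed.

Lemma stochasticX X n : stochastic X -> stochastic (X ^+ n)%R.
Proof.
move=> mX; elim: n => [|n IHn]; first by rewrite expr0; exact: stochastic1.
by rewrite exprS; exact: stochasticM.
Qed.

Definition mix (d : R) X Y : nker R G E := (nscal (1 - d) * X + nscal d * Y)%R.

Lemma mixE (d : R) X Y x i j : (0 <= d <= 1)%R ->
  mix d X Y x i j = (1 - d)%:E * X x i j + d%:E * Y x i j.
Proof. by move=> /andP[d0 d1]; rewrite /mix naddE !nscalE// subr_ge0. Qed.

Lemma stochastic_mix (d : R) X Y : (0 <= d <= 1)%R ->
  stochastic X -> stochastic Y -> stochastic (mix d X Y).
Proof.
move=> d01 mX mY i; have /andP[d0 d1] := d01.
have d1' : 0 <= (1 - d)%:E by rewrite lee_fin subr_ge0.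
under eq_esum => c _ do rewrite mixE//.
rewrite esumD; [|by move=> *; exact: mule_ge0..].
by rewrite !ge0_esumZl// mX mY !mule1 -EFinD subrK.
Qed.

Lemma stochastic_le1 X x i j : stochastic X -> X x i j <= 1.
Proof.
move=> mX; rewrite -(mX i).
exact: (@esum_ub1 _ _ (fun c : G * E => X c.1 i c.2) (x, j)).
Qed.

Lemma stochastic_fin X x i j : stochastic X -> X x i j \is a fin_num.
Proof.
move=> mX; rewrite ge0_fin_numE//.
by rewrite (le_lt_trans (stochastic_le1 _ _ _ mX))// ltry.
Qed.

Lemma tau_le X : stochastic X -> tau X <= (#|E|%:R : R)%:E.
Proof.
move=> mX; rewrite (le_trans (lee_sum _ (fun i _ => stochastic_le1 1%g i i mX)))//.
by rewrite sumEFin big_const iter_addr addr0 -mulr_natr mul1r lexx.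
Qed.

Lemma tau_fin X : stochastic X -> tau X \is a fin_num.
Proof.
move=> mX; rewrite ge0_fin_numE ?tau_ge0//.
by rewrite (le_lt_trans (tau_le mX))// ltry.
Qed.

End NkerTrace.

(** * Reversibility and quadratic forms *)

Section Reversible.
Context {R : realType} {G : groupType} {E : finType}.
Variables (m : E -> R) (m_gt0 : forall i, 0 < m i).
Implicit Types X Y U V B Q C : nker R G E.
Local Open Scope ereal_scope.

Let m_ge0 i : 0 <= (m i)%:E. Proof. by rewrite lee_fin ltW. Qed.

(** With weight $m_i$ at $(x,i)$, [Y] is the adjoint of [X] in $\ell^2(m)$. Exchanging the endpoints
    replaces $x^{-1}y$ by its inverse. Detailed balance is [adjoint X X]. *)
Definition adjoint X Y :=
  forall x i j, (m i)%:E * X x i j = (m j)%:E * Y (x^-1)%g j i.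

Lemma adjoint1 : adjoint 1%R 1%R.
Proof.
move=> x i j; rewrite !noneE invg_eq1 (eq_sym j).
by case: eqP => [_|_]; case: eqP => [->|_] //=; rewrite !mule0.
Qed.

Lemma adjointM X X' Y Y' : adjoint X X' -> adjoint Y Y' -> adjoint (X * Y)%R (Y' * X')%R.
Proof.
move=> hX hY x i j; rewrite !nmulE.
rewrite -!ge0_esumZl//; [|by move=> c; exact: mule_ge0..].
rewrite [RHS](esum_mulg (x^-1)%g); apply: eq_esum => c _ /=.
have /esym := hY (c.1^-1 * x)%g c.2 j; rewrite invgM invgK => hYc.
by rewrite [LHS]muleA hX [RHS]muleA hYc invgM invgK mulgK muleAC.
Qed.

Lemma adjointD X X' Y Y' : adjoint X X' -> adjoint Y Y' -> adjoint (X + Y)%R (X' + Y')%R.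
Proof. by move=> hX hY x i j; rewrite !naddE !ge0_muleDr// hX hY. Qed.

Lemma adjoint_nscal (c : R) : adjoint (nscal c) (nscal c).
Proof. by move=> x i j; rewrite /= muleCA adjoint1 muleCA. Qed.

Lemma adjointX X n : adjoint X X -> adjoint (X ^+ n)%R (X ^+ n)%R.
Proof.
move=> hX; elim: n => [|n IHn]; first by rewrite expr0; exact: adjoint1.
by rewrite {1}exprS exprSr; exact: adjointM.
Qed.

Lemma adjoint_mix (d : R) X Y : adjoint X X -> adjoint Y Y ->
  adjoint (mix d X Y) (mix d X Y).
Proof.
move=> hX hY; rewrite /mix; apply: adjointD.
  by rewrite {2}nscalC; apply: adjointM => //; exact: adjoint_nscal.
by rewrite {2}nscalC; apply: adjointM => //; exact: adjoint_nscal.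
Qed.

Lemma adjoint_inv X Y x i j : adjoint X Y ->
  Y (x^-1)%g j i = (m i / m j)%:E * X x i j.
Proof.
move=> XY; rewrite mulrC EFinM -muleA XY muleA -EFinM mulVf ?mul1e//.
by rewrite gt_eqF.
Qed.

(** This presents the trace as a weighted inner product of the entries of [U] and [V], the setting
    for Cauchy-Schwarz. *)
Lemma tau_adjoint U V V' : adjoint V V' -> tau (U * V')%R =
  \sum_(i : E) \esum_(c in [set: G * E])
    ((m i / m c.2)%:E * (U c.1 i c.2 * V c.1 i c.2)).
Proof.
move=> VV'; apply: eq_bigr => i _; rewrite nmulE; apply: eq_esum => c _.
by rewrite mulg1 (adjoint_inv _ _ _ VV') muleCA.
Qed.

(** Termwise $2uv \le u^2+v^2$ in the inner product of [tau_adjoint], infinite entries included. *)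
Lemma tau_amgm U U' V V' : adjoint U U' -> adjoint V V' ->
  tau (U * V')%R + tau (U * V')%R <= tau (U * U')%R + tau (V * V')%R.
Proof.
move=> UU' VV'.
have mm (i j : E) : 0 <= (m i / m j)%:E by rewrite lee_fin divr_ge0// ltW.
rewrite (tau_adjoint _ VV') (tau_adjoint _ UU') (tau_adjoint _ VV') -!big_split/=.
apply: lee_sum => i _.
rewrite -!esumD; do ?[by move=> c _; do 2?[apply: mule_ge0 => //]].
apply: le_esum => c _; rewrite -!ge0_muleDr//; do ?[exact: mule_ge0].
apply: lee_wpmul2l => //.
move: (U _ _ _) (V _ _ _) (nval_ge0 U c.1 i c.2) (nval_ge0 V c.1 i c.2).
move=> [u| |] [v| |]//; rewrite ?lee_fin => u0 v0.
- by have := sqr_ge0 (u - v)%R; rewrite expr2 => h; nra.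
- by rewrite mulyy addey// leey.
- by rewrite mulyy addye// leey.
Qed.

(** The inner product of $g$ and $Xg$ in $\ell^2(m)$, applied to $g \ge 0$ only, so that all terms
    are nonnegative. *)
Definition form X (g : G * E -> R) : \bar R :=
  \esum_(a in [set: G * E]) \esum_(b in [set: G * E])
    ((m a.2 * (g a * g b))%:E * X (a.1^-1 * b.1)%g a.2 b.2).

(** For a reversible stochastic kernel, twice the inner product of $g$ and $(I-X)g$, that is, twice
    the Dirichlet form. *)
Definition energy X (g : G * E -> R) : \bar R :=
  \esum_(a in [set: G * E]) \esum_(b in [set: G * E])
    ((m a.2 * (g a - g b) ^+ 2)%:E * X (a.1^-1 * b.1)%g a.2 b.2).

Definition sqnorm (g : G * E -> R) : \bar R :=
  \esum_(a in [set: G * E]) (m a.2 * g a ^+ 2)%:E.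

Lemma esum2D (T : choiceType) (u v : T -> T -> \bar R) :
  (forall a b, 0 <= u a b) -> (forall a b, 0 <= v a b) ->
  \esum_(a in [set: T]) \esum_(b in [set: T]) (u a b + v a b) =
  \esum_(a in [set: T]) \esum_(b in [set: T]) u a b +
  \esum_(a in [set: T]) \esum_(b in [set: T]) v a b.
Proof.
move=> u0 v0; rewrite -esumD; [|by move=> a _; exact: esum_ge0..].
by apply: eq_esum => a _; rewrite esumD.
Qed.

Lemma energy_ge0 X g : 0 <= energy X g.
Proof.
do 2!apply: esum_ge0 => ? _; apply: mule_ge0 => //.
by rewrite lee_fin mulr_ge0 ?sqr_ge0// ltW.
Qed.

Lemma form_ge0 X g : (forall a, (0 <= g a)%R) -> 0 <= form X g.
Proof.
move=> g0; do 2!apply: esum_ge0 => ? _; apply: mule_ge0 => //.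
by rewrite lee_fin !mulr_ge0// ltW.
Qed.

Lemma sqnorm_ge0 g : 0 <= sqnorm g.
Proof. by apply: esum_ge0 => a _; rewrite lee_fin mulr_ge0 ?sqr_ge0// ltW. Qed.

(** Expand the square. Both square terms sum to [sqnorm g]: the first by the row sums, the second by
    reversibility and the row sums. The identity is kept free of subtraction because its terms may
    be infinite. *)
Lemma energy_form X g : stochastic X -> adjoint X X -> (forall a, (0 <= g a)%R) ->
  energy X g + (form X g + form X g) = sqnorm g + sqnorm g.
Proof.
move=> mX XX g0.
have w0 a : (0 <= m a)%R by rewrite ltW.
have t1 (a b : G * E) : 0 <= (m a.2 * (g a - g b) ^+ 2)%:E *
    X (a.1^-1 * b.1)%g a.2 b.2.
  by apply: mule_ge0 => //; rewrite lee_fin mulr_ge0 ?sqr_ge0.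
have t2 (a b : G * E) : 0 <= (m a.2 * (g a * g b))%:E *
    X (a.1^-1 * b.1)%g a.2 b.2.
  by apply: mule_ge0 => //; rewrite lee_fin !mulr_ge0.
have t3 (a b c : G * E) : 0 <= (m c.2 * g a ^+ 2)%:E *
    X (c.1^-1 * b.1)%g c.2 b.2.
  by apply: mule_ge0 => //; rewrite lee_fin mulr_ge0 ?sqr_ge0.
have sqnormE : sqnorm g = \esum_(a in [set: G * E]) \esum_(b in [set: G * E])
    ((m a.2 * g a ^+ 2)%:E * X (a.1^-1 * b.1)%g a.2 b.2).
  apply: eq_esum => a _; rewrite ge0_esumZl//; last first.
    by rewrite lee_fin mulr_ge0 ?sqr_ge0.
  rewrite (esum_mulg a.1)/=.
  by under eq_esum => b _ do rewrite mulKg; rewrite mX mule1.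
have sqnormE' : sqnorm g = \esum_(a in [set: G * E]) \esum_(b in [set: G * E])
    ((m a.2 * g b ^+ 2)%:E * X (a.1^-1 * b.1)%g a.2 b.2).
  rewrite exchange_esum// sqnormE; apply: eq_esum => a _; apply: eq_esum => b _.
  rewrite !(mulrC (m _)) !EFinM -!muleA; congr (_ * _).
  by rewrite XX invgM invgK.
rewrite {2}sqnormE' {1}sqnormE -!esum2D//; last first.
  by move=> a b; exact: adde_ge0.
apply: eq_esum => a _; apply: eq_esum => b _.
have /fineK <- := stochastic_fin (a.1^-1 * b.1)%g a.2 b.2 mX.
rewrite -!EFinM -!EFinD; congr EFin; ring.
Qed.

Lemma form_le X g : stochastic X -> adjoint X X -> (forall a, (0 <= g a)%R) ->
  form X g <= sqnorm g.
Proof.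
move=> mX XX g0; have := energy_form mX XX g0.
move: (energy_ge0 X g) (form_ge0 X g0) (sqnorm_ge0 g).
case: (energy X g) => [e| |]//; case: (form X g) => [f| |]//;
  case: (sqnorm g) => [s| |]//=; rewrite ?leey// !lee_fin => e0 f0 s0.
by rewrite -!EFinD => -[h]; lra.
Qed.

Lemma form_comparison (t : R) Q B g :
  stochastic Q -> adjoint Q Q -> stochastic B -> adjoint B B -> (0 <= t)%R ->
  (forall a, (0 <= g a)%R) -> t%:E * energy B g <= energy Q g ->
  form Q g + t%:E * sqnorm g <= sqnorm g + t%:E * form B g.
Proof.
move=> mQ QQ mB BB t0 g0.
have := energy_form mQ QQ g0; have := energy_form mB BB g0.
have := form_le mQ QQ g0; have := form_le mB BB g0.
move: (energy_ge0 B g) (energy_ge0 Q g) (form_ge0 B g0) (form_ge0 Q g0).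
move: (sqnorm_ge0 g).
(* If [sqnorm g] is infinite, so is the right-hand side. Otherwise [form_le] makes the forms finite,
   the energy identities make the energies finite, and real arithmetic applies. *)
case: (sqnorm g) => [s| |]//=; last first.
  move=> _ _ _ fB0 _ _ _ _ _ _.
  by rewrite addye ?leey// -ltNye (lt_le_trans ltNy0)// mule_ge0// lee_fin.
case: (form B g) => [fB| |]//; case: (form Q g) => [fQ| |]//.
case: (energy B g) => [eB| |]//; case: (energy Q g) => [eQ| |]//.
move=> s0 eB0 eQ0 fB0 fQ0 hB hQ; rewrite -!EFinD -!EFinM => -[h1] -[h2].
by rewrite !lee_fin => h3; nra.
Qed.

Lemma sqnorm_form g : (forall a, (0 <= g a)%R) -> sqnorm g = form 1%R g.
Proof.
move=> g0; apply: eq_esum => a _; rewrite (@esum_pick _ _ a).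
- by rewrite noneE mulVg !eqxx mule1 expr2.
- by move=> b; apply: mule_ge0 => //; rewrite lee_fin !mulr_ge0// ltW.
- move=> b ba; rewrite noneE (_ : _ && _ = false) ?mule0//.
  apply: contraNF ba => /andP[/eqP ab1 /eqP ab2].
  rewrite -pair_eqE /pair_eq/= ab2 eqxx andbT.
  by rewrite -[b.1](mulVKg a.1) ab1 mulg1.
Qed.

(** The row of [C] at $(e,i)$, as a density with respect to $m$. *)
Definition nrow C (i : E) (a : G * E) : R := (fine (C a.1 i a.2) / m a.2)%R.

Lemma nrow_ge0 C i a : (0 <= nrow C i a)%R.
Proof. by rewrite divr_ge0 ?fine_ge0// ltW. Qed.

(** This transfers inequalities between quadratic forms to traces: each diagonal entry of $CQC'$ is
    the form of [Q] at a row of [C]. *)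
Lemma tau_form C C' Q : (forall x i j, C x i j \is a fin_num) -> adjoint C C' ->
  tau (C * Q * C')%R = \sum_(i : E) ((m i)%:E * form Q (nrow C i)).
Proof.
move=> Cfin CC'; rewrite (tau_adjoint _ CC'); apply: eq_bigr => i _.
have w0 a : (0 <= m a)%R by rewrite ltW.
have t2 (a b : G * E) : 0 <= (m a.2 * (nrow C i a * nrow C i b))%:E *
    Q (a.1^-1 * b.1)%g a.2 b.2.
  apply: mule_ge0 => //; rewrite lee_fin; do 2?[apply: mulr_ge0 => //]; exact: nrow_ge0.
rewrite -ge0_esumZl//; last by move=> a; exact: esum_ge0.
under [RHS]eq_esum => a _ do rewrite -ge0_esumZl//.
rewrite [RHS]exchange_esum; last by move=> a b; exact: mule_ge0.
apply: eq_esum => b _; rewrite muleCA muleC nmulE.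
rewrite -ge0_esumZl//; last 2 first.
  by apply: mule_ge0 => //; rewrite lee_fin divr_ge0.
  by move=> a; exact: mule_ge0.
apply: eq_esum => a _; rewrite /nrow.
rewrite -(fineK (Cfin b.1 i b.2)) -(fineK (Cfin a.1 i a.2)) !muleA -!EFinM.
congr (_%:E * _); rewrite /=.
have := m_gt0 a.2; have := m_gt0 b.2.
move: (fine _) (fine _) (m a.2) (m b.2) => u v x y y0 x0.
by field; rewrite !gt_eqF.
Qed.

Lemma tau_form1 C C' : (forall x i j, C x i j \is a fin_num) -> adjoint C C' ->
  tau (C * C')%R = \sum_(i : E) ((m i)%:E * sqnorm (nrow C i)).
Proof.
move=> Cfin CC'; rewrite -[C in LHS]mulr1 (tau_form _ Cfin CC').
by apply: eq_bigr => i _; rewrite sqnorm_form//; exact: nrow_ge0.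
Qed.

Lemma tau_contract C C' Q : (forall x i j, C x i j \is a fin_num) -> adjoint C C' ->
  stochastic Q -> adjoint Q Q -> tau (C * Q * C')%R <= tau (C * C')%R.
Proof.
move=> Cfin CC' mQ QQ; rewrite (tau_form _ Cfin CC') (tau_form1 Cfin CC').
apply: lee_sum => i _; apply: lee_wpmul2l => //.
by apply: form_le => // a; exact: nrow_ge0.
Qed.

Lemma tau_comparison (t : R) C C' Q B :
  (forall x i j, C x i j \is a fin_num) -> adjoint C C' ->
  stochastic Q -> adjoint Q Q -> stochastic B -> adjoint B B -> (0 <= t)%R ->
  (forall g, (forall a, (0 <= g a)%R) -> t%:E * energy B g <= energy Q g) ->
  tau (C * Q * C')%R + t%:E * tau (C * C')%R <=
  tau (C * C')%R + t%:E * tau (C * B * C')%R.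
Proof.
move=> Cfin CC' mQ QQ mB BB t0 hen.
rewrite (tau_form Q Cfin CC') (tau_form B Cfin CC') (tau_form1 Cfin CC').
have r0 i a : (0 <= nrow C i a)%R by exact: nrow_ge0.
rewrite !ge0_sume_distrr; do ?by move=> i _; rewrite mule_ge0 ?sqnorm_ge0 ?form_ge0.
rewrite -!big_split/=; apply: lee_sum => i _.
rewrite !(muleCA t%:E) -!ge0_muleDr ?sqnorm_ge0 ?form_ge0//; last 2 first.
  by apply: mule_ge0; rewrite ?form_ge0// lee_fin.
  by apply: mule_ge0; rewrite ?sqnorm_ge0// lee_fin.
by apply: lee_wpmul2l => //; apply: form_comparison => //; exact: hen.
Qed.

End Reversible.

(** * Trace inequalities *)

Section RealTrace.
Context {R : realType} {G : groupType} {E : finType}.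
Implicit Types X Y Z : nker R G E.

Definition tr X : R := fine (tau X).

Lemma tr_ge0 X : 0 <= tr X.
Proof. by rewrite fine_ge0// tau_ge0. Qed.

Lemma tr_le X : stochastic X -> tr X <= #|E|%:R.
Proof. by move=> sX; rewrite -lee_fin fineK ?tau_le// tau_fin. Qed.

Lemma trC X Y : tr (X * Y) = tr (Y * X).
Proof. by rewrite /tr tauC. Qed.

Lemma mixMl (d : R) X Y Z : Z * mix d X Y = mix d (Z * X) (Z * Y).
Proof. by rewrite /mix mulrDr !mulrA -!nscalC. Qed.

Lemma mixMr (d : R) X Y Z : mix d X Y * Z = mix d (X * Z) (Y * Z).
Proof. by rewrite /mix mulrDl !mulrA. Qed.

Lemma tr_mix (d : R) X Y : 0 <= d <= 1 -> stochastic X -> stochastic Y ->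
  tr (mix d X Y) = (1 - d) * tr X + d * tr Y.
Proof.
move=> /andP[d0 d1] sX sY; rewrite /tr /mix tauD !tauZ ?subr_ge0//.
by rewrite fineD ?fineM ?fin_numM ?tau_fin.
Qed.

(** The hypotheses give $\mathrm{tr}(Y^j) \le T 2^{J-j} + a$ for all $j$, from the first bound below
    $J$ and the second beyond. A factor $(1-d)I + dY$ multiplies $2^{-j}$ by $(1-d)+d/2 = 1-d/2$,
    the Laplace transform of a Bernoulli variable. The free exponent $j$ makes the induction on $N$
    go through. *)
Lemma tr_chernoff (d T a : R) (J : nat) Y : 0 <= d <= 1 -> stochastic Y ->
  0 <= T -> 0 <= a -> (forall j, tr (Y ^+ j) <= T) ->
  (forall j, (J <= j)%N -> tr (Y ^+ j) <= a) ->
  forall N j, tr (Y ^+ j * mix d 1 Y ^+ N) <=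
    T * 2 ^+ J * 2^-1 ^+ j * (1 - d / 2) ^+ N + a.
Proof.
move=> d01 sY T0 a0 YT Ya; elim=> [|N IHN] j.
  rewrite !expr0 !mulr1; have [Jj|jJ] := leqP J j.
    by rewrite (le_trans (Ya j Jj))// lerDr !mulr_ge0// exprn_ge0// invr_ge0.
  rewrite (le_trans (YT j))// -[leLHS]addr0 lerD// -mulrA ler_peMr//.
  rewrite exprVn -(subnK (ltnW jJ)) exprD mulfK ?exprn_ege1 ?ler1n//.
have sW n : stochastic (mix d 1 Y ^+ n).
  by apply: stochasticX; apply: stochastic_mix => //; exact: stochastic1.
have sYX n : stochastic (Y ^+ n) by exact: stochasticX.
rewrite exprS mulrA mixMl mulr1 -exprSr mixMr tr_mix//; try exact: stochasticM.
have /andP[d0 d1] := d01.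
have h1 : (1 - d) * tr (Y ^+ j * mix d 1 Y ^+ N) <=
    (1 - d) * (T * 2 ^+ J * 2^-1 ^+ j * (1 - d / 2) ^+ N + a).
  by rewrite ler_wpM2l ?subr_ge0.
have h2 : d * tr (Y ^+ j.+1 * mix d 1 Y ^+ N) <=
    d * (T * 2 ^+ J * 2^-1 ^+ j.+1 * (1 - d / 2) ^+ N + a).
  by rewrite ler_wpM2l.
apply: (le_trans (lerD h1 h2)); rewrite !exprS le_eqVlt; apply/orP; left.
by apply/eqP; field.
Qed.

(** Among $N+1 \ge 1$ fair tosses the parity is uniform, so half of the mass lies at even powers of
    $Y$. The odd powers are dropped, their traces being nonnegative. *)
Lemma tr_half_ge (u : R) (n : nat) Y : stochastic Y ->
  (forall j, ~~ odd j -> (j <= n)%N -> u <= tr (Y ^+ j)) ->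
  forall N j, (j + N.+1 <= n)%N -> 2^-1 * u <= tr (Y ^+ j * mix 2^-1 1 Y ^+ N.+1).
Proof.
move=> sY hu.
have h01 : 0 <= (2^-1 : R) <= 1 by apply/andP; split; lra.
have sYX k : stochastic (Y ^+ k) by exact: stochasticX.
have sW k : stochastic (mix 2^-1 1 Y ^+ k).
  by apply: stochasticX; apply: stochastic_mix => //; exact: stochastic1.
elim=> [|N IHN] j jn.
  rewrite expr1 mixMl mulr1 -exprSr tr_mix//.
  have := tr_ge0 (Y ^+ j); have := tr_ge0 (Y ^+ j.+1).
  case: (boolP (odd j)) => oj.
    by have := hu j.+1; rewrite /= oj -addn1 => /(_ isT jn); lra.
  by have := hu j oj (leq_trans (leq_addr _ _) jn); lra.
rewrite exprS mulrA mixMl mulr1 -exprSr mixMr tr_mix//; try exact: stochasticM.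
have := IHN j; have := IHN j.+1.
rewrite addSnnS => /(_ jn) h1 /(_ (leq_trans _ jn)); rewrite leq_add2l leqnSn.
by move=> /(_ isT); lra.
Qed.

End RealTrace.

(** * Monotonicity of traces under comparison of quadratic forms *)

Section ReversibleTrace.
Context {R : realType} {G : groupType} {E : finType}.
Variables (m : E -> R) (m_gt0 : forall i, 0 < m i).
Implicit Types X Y A B P Q C U V : nker R G E.

Lemma tr_amgm U U' V V' : stochastic U -> stochastic U' -> stochastic V ->
  stochastic V' -> adjoint m U U' -> adjoint m V V' ->
  2 * tr (U * V') <= tr (U * U') + tr (V * V').
Proof.
move=> sU sU' sV sV' UU' VV'; have := tau_amgm m_gt0 UU' VV'.
have t := fun X Y sX sY => fineK (tau_fin (@stochasticM _ _ _ X Y sX sY)).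
rewrite -(t U V')// -(t U U')// -(t V V')// -!EFinD lee_fin /tr; lra.
Qed.

Lemma tr_contract C Q : stochastic C -> adjoint m C C ->
  stochastic Q -> adjoint m Q Q -> tr (C * Q * C) <= tr (C * C).
Proof.
move=> sC CC sQ QQ; rewrite fine_le ?tau_fin//; do ?exact: stochasticM.
  by do ?[apply: stochasticM => //].
by apply: tau_contract => // x i j; exact: stochastic_fin.
Qed.

Lemma tr_comparison (t : R) C Q B : stochastic C -> adjoint m C C ->
  stochastic Q -> adjoint m Q Q -> stochastic B -> adjoint m B B -> 0 <= t ->
  (forall g, (forall a, 0 <= g a) ->
    (t%:E * energy m B g <= energy m Q g)%E) ->
  tr (C * Q * C) + t * tr (C * C) <= tr (C * C) + t * tr (C * B * C).
Proof.
move=> sC CC sQ QQ sB BB t0 hen.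
have Cfin x i j : C x i j \is a fin_num by exact: stochastic_fin.
have := tau_comparison m_gt0 Cfin CC sQ QQ sB BB t0 hen.
have t' := fun X Y sX sY => fineK (tau_fin (@stochasticM _ _ _ X Y sX sY)).
rewrite -(t' (C * Q) C)//; last exact: stochasticM.
rewrite -(t' (C * B) C)//; last exact: stochasticM.
by rewrite -(t' C C).
Qed.

(** The comparison is used for the single kernel $C = A^{2^k-1}$: by cyclicity its two sides are
    $\mathrm{tr}(A^{2 \cdot 2^k})$ and the first term $b_0$ of the chain. *)
Lemma tr_pow2_le A Y k : stochastic A -> adjoint m A A -> stochastic Y ->
  adjoint m Y Y -> tr (A ^+ (2 ^ k).-1 * A ^+ 2 * A ^+ (2 ^ k).-1) <=
               tr (A ^+ (2 ^ k).-1 * Y * A ^+ (2 ^ k).-1) ->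
  tr (A ^+ (2 * 2 ^ k)) <= tr (Y ^+ (2 ^ k)).
Proof.
move=> sA AA sY YY; have N0 : (0 < 2 ^ k)%N by rewrite expn_gt0.
have sAX n : stochastic (A ^+ n) by exact: stochasticX.
have sYX n : stochastic (Y ^+ n) by exact: stochasticX.
have AAX n : adjoint m (A ^+ n) (A ^+ n) by exact: adjointX.
have YYX n : adjoint m (Y ^+ n) (Y ^+ n) by exact: adjointX.
rewrite -!exprD trC mulrA -exprD.
have -> : ((2 ^ k).-1 + 2 + (2 ^ k).-1 = 2 * 2 ^ k)%N by lia.
have -> : ((2 ^ k).-1 + (2 ^ k).-1 = 2 * (2 ^ k - 2 ^ 0))%N by lia.
move=> b0.
pose b i := tr (A ^+ (2 * (2 ^ k - 2 ^ i)) * Y ^+ (2 ^ i)).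
have bS i : (i < k)%N -> 2 * b i <= tr (A ^+ (2 * 2 ^ k)) + b i.+1.
  move=> ik; have ik' : (2 ^ i.+1 <= 2 ^ k)%N by rewrite leq_exp2l.
  have ik2 : (2 * 2 ^ i <= 2 ^ k)%N by rewrite -expnS.
  (* Cauchy-Schwarz for $U = A^N$ and $V = Y^{2^i} A^{N - 2^{i+1}}$ with $N = 2^k$: the mixed trace
     is $b_i$ and that of $V$ with its adjoint is $b_{i+1}$. *)
  have := tr_amgm (sAX (2 ^ k)%N) (sAX _)
    (stochasticM (sYX (2 ^ i)%N) (sAX (2 ^ k - 2 ^ i.+1)%N))
    (stochasticM (sAX _) (sYX _)) (AAX _) (adjointM m_gt0 (YYX _) (AAX _)).
  have -> : tr (Y ^+ (2 ^ i) * A ^+ (2 ^ k - 2 ^ i.+1) *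
      (A ^+ (2 ^ k - 2 ^ i.+1) * Y ^+ (2 ^ i))) = b i.+1.
    rewrite mulrA -(mulrA (Y ^+ _) (A ^+ _) (A ^+ _)) -exprD trC mulrA -exprD trC /b.
    by rewrite !addnn -!mul2n -expnS.
  rewrite mulrA -!exprD addnn -mul2n.
  suff -> : (2 ^ k + (2 ^ k - 2 ^ i.+1) = 2 * (2 ^ k - 2 ^ i))%N by [].
  by rewrite expnS; lia.
have := midpoint_seq_ge bS; rewrite /b subnn muln0 expr0 mul1r expr1.
exact.
Qed.

Lemma energy_le (t : R) B Q g : 0 <= t ->
  (forall x i j, (t%:E * B x i j <= Q x i j)%E) ->
  (t%:E * energy m B g <= energy m Q g)%E.
Proof.
move=> t0 BQ.
have w (a b : G * E) : (0 <= (m a.2 * (g a - g b) ^+ 2)%:E)%E.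
  by rewrite lee_fin mulr_ge0 ?sqr_ge0// ltW.
have w' (a b : G * E) : (0 <= (m a.2 * (g a - g b) ^+ 2)%:E *
    B (a.1^-1 * b.1)%g a.2 b.2)%E by exact: mule_ge0.
rewrite -ge0_esumZl//; last by move=> a; exact: esum_ge0.
apply: le_esum => a _; rewrite -ge0_esumZl//.
by apply: le_esum => b _; rewrite muleCA; apply: lee_wpmul2l.
Qed.

Lemma nmul_le (s t : R) X X' Y Y' : 0 <= s -> 0 <= t ->
  (forall x i j, (s%:E * X x i j <= X' x i j)%E) ->
  (forall x i j, (t%:E * Y x i j <= Y' x i j)%E) ->
  forall x i j, ((s * t)%:E * (X * Y)%R x i j <= (X' * Y')%R x i j)%E.
Proof.
move=> s0 t0 hX hY x i j; rewrite !nmulE -ge0_esumZl//; last first.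
- by move=> c; exact: mule_ge0.
- by rewrite lee_fin mulr_ge0.
apply: le_esum => c _; rewrite EFinM muleACA.
by apply: lee_pmul => //; apply: mule_ge0 => //; rewrite lee_fin.
Qed.

(* Convexity of j |-> tr (C P^(2j) C). *)
Lemma tr_convex C P K : stochastic C -> adjoint m C C -> stochastic P -> adjoint m P P ->
  tr (C * C) - tr (C * P ^+ (2 * K) * C) <=
  K%:R * (tr (C * C) - tr (C * P ^+ 2 * C)).
Proof.
move=> sC CC sP PP; pose c j := tr (C * P ^+ (2 * j) * C).
have sPX n : stochastic (P ^+ n) by exact: stochasticX.
have PPX n : adjoint m (P ^+ n) (P ^+ n) by exact: adjointX.
have cc j : 2 * c j.+1 <= c j + c j.+2.
  (* With $U = CP^j$ and $V = CP^{j+2}$ the mixed product is $CP^{2j+2}C$, the midpoint. *)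
  have := tr_amgm (stochasticM sC (sPX j)) (stochasticM (sPX j) sC)
    (stochasticM sC (sPX j.+2)) (stochasticM (sPX j.+2) sC)
    (adjointM m_gt0 CC (PPX _)) (adjointM m_gt0 CC (PPX _)).
  have CPC a b : C * P ^+ a * (P ^+ b * C) = C * P ^+ (a + b) * C.
    by rewrite mulrA -(mulrA C) -exprD.
  rewrite !CPC /c (_ : j + j.+2 = 2 * j.+1)%N; last by lia.
  by rewrite !addnn -!mul2n.
by have := convex_seq_le cc K; rewrite /c muln0 expr0 mulr1 muln1.
Qed.

(** Squaring the pointwise bound gives $I - P^{2K} \ge \epsilon^2 (I - B^2)$, and convexity gives
    $K(I-P^2) \ge I - P^{2K}$ after sandwiching between $C$ and taking traces. The denominator $K+1$
    covers $K = 0$. *)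
Lemma tr_irreducible_le (eps : R) P B K k : 0 < eps -> eps <= 1 ->
  stochastic P -> adjoint m P P -> stochastic B -> adjoint m B B ->
  (forall x i j, (eps%:E * B x i j <= (P ^+ K)%R x i j)%E) ->
  tr (P ^+ (2 * 2 ^ k)) <= tr (mix (eps ^+ 2 / K.+1%:R) 1 (B ^+ 2) ^+ (2 ^ k)).
Proof.
move=> e0 e1 sP PP sB BB hPB.
set d := eps ^+ 2 / K.+1%:R.
have sPX n : stochastic (P ^+ n) by exact: stochasticX.
have PPX n : adjoint m (P ^+ n) (P ^+ n) by exact: adjointX.
have sB2 : stochastic (B ^+ 2) by exact: stochasticX.
have BB2 : adjoint m (B ^+ 2) (B ^+ 2) by exact: adjointX.
have ee : 0 <= eps ^+ 2 <= 1 by rewrite sqr_ge0 expr_le1// ltW.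
have d01 : 0 <= d <= 1.
  rewrite divr_ge0 ?sqr_ge0//= ler_pdivrMr// mul1r (le_trans (andP ee).2)//.
  by rewrite ler1n.
have s1 : stochastic (1 : nker R G E) by exact: stochastic1.
apply: tr_pow2_le => //.
- exact: stochastic_mix.
- exact (adjoint_mix m_gt0 d (adjoint1 m) BB2).
set C := P ^+ _.
have sC : stochastic C by exact: sPX.
have CC : adjoint m C C by exact: PPX.
rewrite mixMl mixMr mulr1.
rewrite (tr_mix d01 (stochasticM sC sC) (stochasticM (stochasticM sC sB2) sC)).
have hen g : (forall a, 0 <= g a) ->
    ((eps ^+ 2)%:E * energy m (B ^+ 2)%R g <= energy m (P ^+ (2 * K))%R g)%E.
  move=> _; apply: energy_le (andP ee).1 _ => x i j.
  rewrite expr2 mul2n -addnn exprD [B ^+ 2]expr2.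
  exact: (nmul_le (ltW e0) (ltW e0) hPB hPB).
have := tr_comparison sC CC (sPX _) (PPX _) sB2 BB2 (andP ee).1 hen.
have := tr_convex K sC CC sP PP.
have := tr_contract sC CC (sPX 2%N) (PPX 2%N).
set z := tr (C * C); set c1 := tr (_ * P ^+ 2 * _); set cK := tr (_ * P ^+ _ * _).
set y := tr (C * B ^+ 2 * C) => h1 h2 h3.
have K0 : 0 <= K%:R :> R by [].
have KS : K.+1%:R = K%:R + 1 :> R by rewrite natr1.
(* Here $K(z-c_1) \ge z - c_K \ge \epsilon^2(z-y)$; passing from $K$ to $K+1$ uses the contraction
   bound $c_1 \le z$. *)
have hK : K.+1%:R * c1 <= K.+1%:R * ((1 - d) * z + d * y).
  have -> : K.+1%:R * ((1 - d) * z + d * y) =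
      K.+1%:R * z - eps ^+ 2 * (z - y).
    by rewrite /d KS; field; rewrite -KS pnatr_eq0.
  by rewrite KS; nra.
by move: hK; rewrite ler_pM2l// ltr0n.
Qed.

(** In $((I+B)/2)^2 = I/4 + B/2 + B^2/4$ drop the outer terms. The energy of the lazy square is thus
    at least half that of $B$. *)
Lemma lazy_sq_ge B x i j : (2^-1%:E * B x i j <= (mix 2^-1 1 B ^+ 2)%R x i j)%E.
Proof.
have h01 : 0 <= (2^-1 : R) <= 1 by apply/andP; split; lra.
have h : (1 : R) - 2^-1 = 2^-1 by lra.
have h0 : (0 <= (2^-1 : R)%:E)%E by rewrite lee_fin; lra.
rewrite expr2 mixMr mul1r mixMl mulr1 !mixE// !h.
set b := B x i j; have b0 : (0 <= b)%E by exact: nval_ge0.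
rewrite -ge0_muleDr; do ?[apply: adde_ge0; exact: mule_ge0].
apply: lee_wpmul2l => //.
rewrite -{1}[b]mul1e (_ : 1%E = (2^-1 + 2^-1)%:E); last by congr EFin; lra.
rewrite EFinD ge0_muleDl// leeD//.
  by rewrite leeDr//; exact: mule_ge0.
by rewrite leeDl//; exact: mule_ge0.
Qed.

Lemma tr_lazy_le (t : R) P B k : 0 <= t <= 1 ->
  stochastic P -> adjoint m P P -> stochastic B -> adjoint m B B ->
  (forall g, (forall a, 0 <= g a) ->
    (t%:E * energy m P g <= energy m B g)%E) ->
  tr (mix 2^-1 1 B ^+ (2 * 2 ^ k)) <= tr (mix (t / 2) 1 P ^+ (2 ^ k)).
Proof.
move=> /andP[t0 t1] sP PP sB BB hPB.
have h01 : 0 <= (2^-1 : R) <= 1 by apply/andP; split; lra.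
have d01 : 0 <= t / 2 <= 1 by apply/andP; split; lra.
have s1 : stochastic (1 : nker R G E) by exact: stochastic1.
have A1 : adjoint m (1 : nker R G E) 1 by exact: adjoint1.
set L := mix 2^-1 1 B.
have sL : stochastic L by exact: stochastic_mix.
have LL : adjoint m L L by exact: adjoint_mix.
apply: tr_pow2_le => //; [exact: stochastic_mix|exact: adjoint_mix|].
set C := L ^+ _.
have sC : stochastic C by exact: stochasticX.
have CC : adjoint m C C by exact: adjointX.
rewrite mixMl mixMr mulr1.
rewrite (tr_mix d01 (stochasticM sC sC) (stochasticM (stochasticM sC sP) sC)).
have := @tr_comparison (t / 2) C (L ^+ 2) P sC CC (stochasticX _ sL)
  (adjointX m_gt0 _ LL) sP PP (andP d01).1.
suff hL g : (forall a, 0 <= g a) ->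
    ((t / 2)%:E * energy m P g <= energy m (L ^+ 2)%R g)%E.
  by move=> /(_ hL); lra.
move=> g0; apply: (@le_trans _ _ (2^-1%:E * energy m B g)%E); last first.
  by apply: energy_le => [|x i j]; [lra|exact: lazy_sq_ge].
rewrite mulrC EFinM -muleA; apply: lee_wpmul2l; last exact: hPB.
by rewrite lee_fin; lra.
Qed.

End ReversibleTrace.

(** * Powers of Markov kernels and of the uniform measure *)

Section KernelLink.
Context {R : realType} {G : groupType} {E : finType}.
Variables (p : G * E -> G * E -> R).
Hypothesis p_markov : markov_kernel p.
Hypothesis p_inv : forall (g x y : G) (i j : E),
  p ((g * x)%g, i) ((g * y)%g, j) = p (x, i) (y, j).
Local Open Scope ereal_scope.

Lemma kernel_nval_ge0 x i j : 0 <= (p (1%g, i) (x, j))%:E.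
Proof. by rewrite lee_fin; have [+ _] := p_markov; apply. Qed.

Definition nker_of : nker R G E := Nker _ kernel_nval_ge0.

Lemma nker_ofE x y i j : (p (x, i) (y, j))%:E = nker_of (x^-1 * y)%g i j.
Proof. by rewrite /= -{1}[x]mulg1 -{1}[y](mulVKg x) p_inv. Qed.

Lemma stochastic_nker_of : stochastic nker_of.
Proof.
move=> i; have [_ /(_ (1%g, i)) <-] := p_markov.
by apply: eq_esum => -[].
Qed.

(** Powers of a stochastic kernel have finite entries, so the [fine] in [kernel_pow] discards
    nothing. *)
Lemma kernel_powE n a b :
  (kernel_pow p n a b)%:E = (nker_of ^+ n)%R (a.1^-1 * b.1)%g a.2 b.2.
Proof.
elim: n a b => [|n IHn] [x i] [y j] /=.
  by rewrite mulg_eq1 (can_eq invgK) xpair_eqE.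
rewrite (_ : esum _ _ = (nker_of ^+ n.+1)%R (x^-1 * y)%g i j) ?fineK//.
  by apply: stochastic_fin; apply: stochasticX; exact: stochastic_nker_of.
rewrite exprSr nmulE (esum_mulg (x^-1)%g); apply: eq_esum => -[z k] _ /=.
by rewrite EFinM IHn/= nker_ofE invgM invgK mulgA mulgK.
Qed.

Lemma sum_kernel_pow n :
  (\sum_(i : E) kernel_pow p n (1%g, i) (1%g, i))%R = tr (nker_of ^+ n)%R.
Proof.
rewrite /tr /tau (eq_bigr (fun i => (kernel_pow p n (1%g, i) (1%g, i))%:E)).
  by rewrite sumEFin.
by move=> i _; rewrite kernel_powE mulVg.
Qed.

End KernelLink.

(** * The uniform walk on the group, with resampled fibre coordinate *)

Section UniformWalk.
Context {R : realType} {G : groupType} {E : finType}.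
Variables (S : {fset G}) (m : E -> R).
Hypothesis S_sym : symmetric_fset S.
Hypothesis S_neq0 : S != fset0.
Hypothesis m_gt0 : forall i, (0 < m i)%R.
Hypothesis E_gt0 : (0 < #|E|)%N.
Local Open Scope ereal_scope.

Definition mass : R := (\sum_(i : E) m i)%R.

Lemma mass_gt0 : (0 < mass)%R.
Proof.
have /card_gt0P [i _] := E_gt0.
rewrite /mass (bigD1 i)//= ltr_pwDl//.
by apply: sumr_ge0 => j _; exact: ltW.
Qed.

Lemma sum_mass : (\sum_(i : E) m i / mass)%R = 1%R.
Proof. by rewrite -mulr_suml divff// gt_eqF// mass_gt0. Qed.

Lemma card_S_gt0 : (0 < #|` S|%:R :> R)%R.
Proof. by rewrite ltr0n lt0n cardfs_eq0. Qed.

Lemma unif_prob_ge0 x : (0 <= unif_prob R S x)%R.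
Proof. by rewrite divr_ge0. Qed.

Lemma unif_probV x : unif_prob R S (x^-1)%g = unif_prob R S x.
Proof.
rewrite /unif_prob; congr (_%:R / _)%R; apply: congr1.
by apply/idP/idP => /S_sym; rewrite ?invgK.
Qed.

Lemma unif_walk_ge0 x (i j : E) : 0 <= (unif_prob R S x * (m j / mass))%:E.
Proof.
by rewrite lee_fin !mulr_ge0 ?unif_prob_ge0// ?invr_ge0 ltW// mass_gt0.
Qed.

(* At each step the second coordinate is resampled from m / mass, so that the
   powers of this kernel have the same trace as those of mu_S. *)
Definition unif_walk : nker R G E := Nker _ unif_walk_ge0.

Lemma esum_unif_prob : \esum_(x in [set: G]) (unif_prob R S x)%:E = 1.
Proof.
transitivity (\esum_(x in [set` S]) (#|` S|%:R^-1 : R)%:E).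
  rewrite [RHS]esum_mkcond; apply: eq_esum => x _; rewrite /unif_prob.
  by rewrite mem_setE; case: (x \in S); rewrite ?mul1r ?mul0r.
rewrite esum_fset//.
rewrite fsbig_finite//= set_fsetK sumEFin big_const_seq count_predT iter_addr.
by rewrite addr0; congr EFin; rewrite -[LHS]mulr_natl divff // gt_eqF // card_S_gt0.
Qed.

Lemma stochastic_unif_walk : stochastic unif_walk.
Proof.
move=> i; rewrite esum_GE => [/=|c]; last exact: (nval_ge0 unif_walk).
under eq_bigr => k _.
  under eq_esum => x _ do rewrite EFinM.
  rewrite ge0_esumZr ?lee_fin ?divr_ge0 ?ltW ?mass_gt0//; last first.
    by move=> x; rewrite lee_fin unif_prob_ge0.
  rewrite esum_unif_prob mul1e; over.
by rewrite sumEFin sum_mass.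
Qed.

Lemma adjoint_unif_walk : adjoint m unif_walk unif_walk.
Proof. by move=> x i j /=; rewrite unif_probV -!EFinM; congr EFin; ring. Qed.

Lemma conv_pow_ge0 n x : (0 <= conv_pow (unif_prob R S) n x)%R.
Proof.
case: n => [|n]; first by rewrite ler0n.
elim: n x => [|n IHn] x; rewrite fine_ge0// esum_ge0// => y _.
  by rewrite lee_fin mulr_ge0 ?unif_prob_ge0.
by rewrite lee_fin mulr_ge0 ?unif_prob_ge0// IHn.
Qed.

(** After at least one step the coordinate in $E$ has law $m/M$, where $M$ is [mass], independently
    of the position in $G$. The exponent starts at 1 because the identity kernel resamples
    nothing. *)
Lemma conv_powE n x i j :
  (unif_walk ^+ n.+1)%R x i j = (conv_pow (unif_prob R S) n.+1 x * (m j / mass))%:E.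
Proof.
have w0 k : (0 < m k / mass)%R by rewrite divr_gt0 ?mass_gt0.
elim: n x i j => [|n IHn] x i j.
  rewrite expr1 /=; congr EFin; congr (_ * _)%R.
  rewrite /convolution (@esum_pick _ _ 1%g) => [|y|y y1].
  - by rewrite eqxx mul1r invg1 mul1g.
  - by rewrite lee_fin mulr_ge0 ?unif_prob_ge0.
  - by rewrite (negbTE y1) mul0r.
set V := \esum_(y in [set: G]) (conv_pow (unif_prob R S) n.+1 y *
    unif_prob R S (y^-1 * x)%g)%:E.
have t0 y : 0 <= (conv_pow (unif_prob R S) n.+1 y *
    unif_prob R S (y^-1 * x)%g)%:E.
  by rewrite lee_fin mulr_ge0 ?unif_prob_ge0 ?conv_pow_ge0.
have V0 : 0 <= V by exact: esum_ge0.
have uE : (unif_walk ^+ n.+2)%R x i j = (m j / mass)%:E * V.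
  rewrite exprSr nmulE esum_GE; last by move=> c; exact: mule_ge0.
  transitivity (\sum_(k : E) (m k / mass * (m j / mass))%:E * V).
    apply: eq_bigr => k _; rewrite -ge0_esumZl//; last first.
      by rewrite lee_fin mulr_ge0// ltW.
    apply: eq_esum => y _; rewrite IHn -!EFinM; congr EFin; ring.
  rewrite -ge0_sume_distrl; last by move=> k _; rewrite lee_fin mulr_ge0// ltW.
  by rewrite sumEFin -mulr_suml sum_mass mul1r.
(* A positive multiple of [V] is an entry of a stochastic kernel, so [fine] in [convolution] does
   not truncate. *)
have Vfin : V \is a fin_num.
  have := stochastic_fin x i j (stochasticX n.+2 stochastic_unif_walk).
  rewrite uE; case: (V) V0 => [v| |]// _.
  by rewrite gt0_muley ?lte_fin.
by rewrite uE -[X in _ * X = _](fineK Vfin) -EFinM mulrC.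
Qed.

Lemma tr_unif_walk n :
  tr (unif_walk ^+ n.+1)%R = conv_pow (unif_prob R S) n.+1 1%g.
Proof.
rewrite /tr /tau; under eq_bigr => i _ do rewrite conv_powE.
by rewrite sumEFin -mulr_sumr sum_mass mulr1.
Qed.

Lemma conv_pow_le1 n : (conv_pow (unif_prob R S) n 1%g <= 1)%R.
Proof.
case: n => [|n]; first by rewrite /= eqxx.
have /card_gt0P [i _] := E_gt0.
have sW := stochasticX n.+1 stochastic_unif_walk.
have t0 c : 0 <= (unif_walk ^+ n.+1)%R c.1 i c.2 by [].
rewrite -lee_fin -(sW i) esum_GE//.
apply: (@le_trans _ _ (\sum_(k : E) (unif_walk ^+ n.+1)%R 1%g i k)).
  under eq_bigr => k _ do rewrite conv_powE.
  by rewrite sumEFin -mulr_sumr sum_mass mulr1.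
apply: lee_sum => k _.
exact: (@esum_ub1 _ _ (fun x => (unif_walk ^+ n.+1)%R x i k)).
Qed.

Lemma unif_walk_le (X : nker R G E) (eps : R) : (0 <= eps)%R ->
  (forall x i j, x \in S -> eps%:E <= X x i j) ->
  forall x i j, eps%:E * unif_walk x i j <= X x i j.
Proof.
move=> e0 hX x i j; have [xS|xS] := boolP (x \in S).
  rewrite (le_trans _ (hX x i j xS))// -[leRHS]mule1 lee_wpmul2l//.
  exact: stochastic_le1 stochastic_unif_walk.
by rewrite /= /unif_prob (negbTE xS) !mul0r mule0.
Qed.

End UniformWalk.

(** * Invariance of the reversible measure *)

Section InvariantMeasure.
Context {R : realType} {G : groupType} {E : finType}.
Variables (S : {fset G}) (p : G * E -> G * E -> R) (w : G * E -> R).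
Variables (c C eps : R) (K : nat).
Hypothesis S_gen : generates S.
Hypothesis p_markov : markov_kernel p.
Hypothesis p_inv : forall (g x y : G) (i j : E),
  p ((g * x)%g, i) ((g * y)%g, j) = p (x, i) (y, j).
Hypothesis w_rev : forall a b, w a * p a b = p b a * w b.
Hypothesis c_gt0 : 0 < c.
Hypothesis w_bound : forall a, c <= w a <= C.
Hypothesis eps_gt0 : 0 < eps.
Hypothesis p_irr : forall (i j : E) (x y : G), (x^-1 * y)%g \in S ->
  eps <= kernel_pow p K (x, i) (y, j).

Let w_gt0 a : 0 < w a.
Proof. by have /andP[ca _] := w_bound a; exact: lt_le_trans ca. Qed.

Let shift (g : G) (a : G * E) : G * E := ((g * a.1)%g, a.2).

(** The $g$-translate of $w$ is also reversible for the invariant kernel $p$. Dividing the two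
    detailed balance equations, $w(ga)/w(a)$ takes the same value at both ends of an edge. *)
Lemma ratio_step g a b : 0 < p a b ->
  w (shift g a) * w b = w (shift g b) * w a.
Proof.
move=> pab; have pinv u v : p (shift g u) (shift g v) = p u v.
  by case: u v => [u i] [v j]; rewrite p_inv.
have h1 := w_rev a b; have h2 := w_rev (shift g a) (shift g b).
rewrite !pinv in h2.
have pab0 : p a b != 0 by rewrite gt_eqF.
have pba0 : p b a != 0.
  apply/eqP => pba; move: h1; rewrite pba mul0r => /eqP.
  by rewrite mulf_eq0 (negbTE pab0) gt_eqF.
apply: (mulIf pab0); rewrite mulrAC h2 -[RHS]mulrA h1; ring.
Qed.

Lemma ratio_path g n a b : 0 < kernel_pow p n a b ->
  w (shift g a) * w b = w (shift g b) * w a.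
Proof.
elim: n b => [|n IHn] b /=.
  by case: eqP => [->|_]; rewrite ?ltxx// mulrC.
move=> hpos; have p0 u v : 0 <= p u v by have [+ _] := p_markov; apply.
have k0 u v : 0 <= kernel_pow p n u v.
  by rewrite -lee_fin (kernel_powE p_markov p_inv); exact: nval_ge0.
have [h|] := pselect (exists d, 0 < kernel_pow p n a d * p d b).
  have [d] := h; rewrite lt_neqAle eq_sym mulf_eq0 negb_or.
  move=> /andP[/andP[kd pd] _].
  have h1 : w (shift g a) * w d = w (shift g d) * w a.
    by apply: IHn; rewrite lt_neqAle eq_sym kd k0.
  have h2 : w (shift g d) * w b = w (shift g b) * w d.
    by apply: ratio_step; rewrite lt_neqAle eq_sym pd p0.
  have wd : w d != 0 by rewrite gt_eqF.
  apply: (mulIf wd); rewrite mulrAC h1 mulrAC h2; ring.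
move=> /forallNP hn; move: hpos; rewrite esum1 ?ltxx// => d _.
have := hn d => /negP; rewrite -leNgt => hle.
by congr EFin; apply/eqP; rewrite eq_le hle mulr_ge0.
Qed.

(** By irreducibility $w(gx,i)/w(x,i)$ does not depend on $x$. Hence $x \mapsto w(x,i)/w(e,i)$ is a
    homomorphism from $G$ to the positive reals. *)
Lemma ratio_fiber g x i : w ((g * x)%g, i) * w (1%g, i) = w (g, i) * w (x, i).
Proof.
(* [H] consists of the $z$ whose right translation preserves all these ratios; it is a subgroup
   containing [S]. *)
pose H : {pred G} := [pred z | `[< forall g x i,
  w ((g * x)%g, i) * w ((x * z)%g, i) = w ((g * (x * z))%g, i) * w (x, i) >]].
have HS : {subset S <= H}.
  move=> z zS; rewrite inE => h y j.
  have := @ratio_path h K (y, j) ((y * z)%g, j); apply.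
  by apply: (lt_le_trans eps_gt0); apply: p_irr; rewrite mulKg.
have Hgrp : group_closed H.
  split; first by rewrite inE => h y j; rewrite mulg1 mulrC.
  move=> z z'; rewrite !inE => hz hz' h y j.
  have := hz h y j; have := hz' h (y * (z / z'))%g j.
  rewrite -!mulgA mulVg mulg1 => h1 h2.
  have wd : w ((y * z)%g, j) != 0 by rewrite gt_eqF.
  by apply: (mulIf wd); rewrite mulrAC h2 [RHS]mulrAC h1 mulrAC.
have : x \in H by exact: S_gen.
by rewrite inE => /(_ g 1%g i); rewrite !mul1g mulg1 => ->; ring.
Qed.

(** A bounded homomorphism to the positive reals is trivial: a value $r > 1$ at $g$ would give $r^n$
    at $g^n$, against the bounds on $w$. *)
Lemma weight_le g i : w (g, i) <= w (1%g, i).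
Proof.
rewrite leNgt; apply/negP => lt_w.
have [r r1 hr] : exists2 r, 1 < r & w (g, i) = r * w (1%g, i).
  exists (w (g, i) / w (1%g, i)); last by rewrite divfK ?gt_eqF.
  by rewrite ltr_pdivlMr// mul1r.
have hpow n : w ((g ^+ n)%g, i) = r ^+ n * w (1%g, i).
  elim: n => [|n IHn]; first by rewrite expg0 expr0 mul1r.
  have w1 : w (1%g, i) != 0 by rewrite gt_eqF.
  by apply: (mulIf w1); rewrite expgS ratio_fiber hr IHn exprS; ring.
have C_gt0 : 0 < C.
  by have /andP[cw wC] := w_bound (g, i); rewrite (lt_le_trans (w_gt0 _) wC).
have bound n : 1 + n%:R * (r - 1) <= C / c.
  apply: (@le_trans _ _ (r ^+ n)).
    have r0 : 0 <= r - 1 by rewrite subr_ge0 ltW.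
    by have := bernoulli_ineq n r0; rewrite [1 + (r - 1)]addrC subrK.
  have /andP[cw _] := w_bound (1%g, i); have /andP[_] := w_bound ((g ^+ n)%g, i).
  rewrite hpow => hC; rewrite ler_pdivlMr// (le_trans _ hC)// ler_wpM2l//.
  by rewrite exprn_ge0// ltW// (lt_trans _ r1).
have := bound (Num.truncn (C / c / (r - 1))).+1.
have r10 : 0 < r - 1 by rewrite subr_gt0.
have := truncnS_gt (C / c / (r - 1)); rewrite ltr_pdivrMr// => h1 h2.
lra.
Qed.

Lemma weight_invariant g i : w (g, i) = w (1%g, i).
Proof.
apply/eqP; rewrite eq_le weight_le/=.
have := ratio_fiber g (g^-1)%g i; rewrite mulgV => h.
have hV := weight_le (g^-1)%g i.
have := w_gt0 (1%g, i); have := w_gt0 (g, i); have := w_gt0 ((g^-1)%g, i).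
nra.
Qed.

Lemma adjoint_nker_of :
  adjoint (fun i => w (1%g, i)) (nker_of p_markov) (nker_of p_markov).
Proof.
move=> x i j; rewrite /= -!EFinM; congr EFin; rewrite w_rev mulrC.
by rewrite weight_invariant -(p_inv (x^-1)%g x 1%g) mulVg mulg1.
Qed.

End InvariantMeasure.

(** * Word distance and energy *)

Section WordDistance.
Context {R : realType} {G : groupType}.
Variables (S : {fset G}).
Hypothesis S_sym : symmetric_fset S.
Hypothesis S_gen : generates S.

Let word (z : G) (w : seq G) := {subset w <= S} /\ (\prod_(s <- w) s)%g = z.

Lemma exists_word z : exists w, word z w.
Proof.
pose H : {pred G} := [pred z | `[< exists w, word z w >]].
have HS : {subset S <= H}.
  move=> s sS; rewrite inE; exists [:: s]; split.
    by move=> x; rewrite inE => /eqP ->.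
  by rewrite big_seq1.
have Hgrp : group_closed H.
  split; first by rewrite inE; exists [::]; split => //; rewrite big_nil.
  move=> y y'; rewrite !inE => -[w [wS <-]] [w' [w'S <-]].
  exists (w ++ rev (map (fun s => s^-1)%g w')); split.
    move=> x; rewrite mem_cat mem_rev => /orP[/wS//|/mapP[s /w'S sS ->]].
    exact: S_sym.
  rewrite big_cat/=; congr (_ * _)%g.
  elim: w' {w'S} => [|s w' IHw']; first by rewrite !big_nil invg1.
  by rewrite /= rev_cons -cats1 big_cat/= big_seq1 IHw' big_cons invgM.
have : z \in H := S_gen Hgrp HS z.
by rewrite inE.
Qed.

(** Since [S] generates, the infimum runs over a nonempty set of natural numbers and is a
    minimum. *)
Lemma word_dist_attained z : exists2 w, word z w & word_dist R S 1%g z = (size w)%:R.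
Proof.
pose Q n := `[< exists2 w, word z w & size w = n >].
have exQ : exists n, Q n.
  by have [w zw] := exists_word z; exists (size w); apply: asboolT; exists w.
case: (ex_minnP exQ) => n /asboolW[w zw wn] minn.
exists w => //; rewrite wn /word_dist.
set A := [set _ | _ in _].
have An : A n%:R.
  by exists w; rewrite /= ?wn//; case: zw => wS <-; split => //; rewrite mul1g.
have lbA : lbound A n%:R.
  move=> _ [w' [w'S +] <-]; rewrite mul1g => w'z; rewrite ler_nat.
  by apply: minn; apply: asboolT; exists w'.
apply/eqP; rewrite eq_le ge_inf/=; last 2 first.
- by exists n%:R.
- exact: An.
by apply: lb_le_inf => //; exists n%:R.
Qed.

End WordDistance.

(** * Bounding the energy by that of the uniform walk through words *)

Section EnergyComparison.
Context {R : realType} {G : groupType} {E : finType}.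
Variables (S : {fset G}) (m : E -> R).
Hypothesis S_sym : symmetric_fset S.
Hypothesis S_neq0 : S != fset0.
Hypothesis S_gen : generates S.
Hypothesis m_gt0 : forall i, 0 < m i.
Hypothesis E_gt0 : (0 < #|E|)%N.
Variable g : G * E -> R.
Implicit Types x y z s : G.

Let M := mass m.
Let M_gt0 : 0 < M := mass_gt0 m_gt0 E_gt0.
Let mu i := m i / M.
Let mu_gt0 i : 0 < mu i. Proof. by rewrite divr_gt0. Qed.

(** Up to the factor [M], the mean square difference of $g$ between independent $m$-random points of
    the fibres over $x$ and $y$. It need not vanish for $x = y$. *)
Let gap x y : R := \sum_i \sum_j m i * mu j * (g (x, i) - g (y, j)) ^+ 2.

Let gap_ge0 x y : 0 <= gap x y.
Proof.
apply: sumr_ge0 => i _; apply: sumr_ge0 => j _.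
by rewrite mulr_ge0 ?sqr_ge0// mulr_ge0// ltW.
Qed.

(** Average $(u-v)^2 \le (1+t)(u-q)^2 + (1+t^{-1})(q-v)^2$ over an independent third point of the
    fibre over $y$. *)
Lemma gap_triangle t x y z : 0 < t ->
  gap x z <= (1 + t) * gap x y + (1 + t^-1) * gap y z.
Proof.
move=> t0.
have smu : \sum_k mu k = 1 by exact: sum_mass m_gt0 E_gt0.
have pt (u q v : R) :
    (u - v) ^+ 2 <= (1 + t) * (u - q) ^+ 2 + (1 + t^-1) * (q - v) ^+ 2.
  rewrite -subr_ge0.
  have -> : (1 + t) * (u - q) ^+ 2 + (1 + t^-1) * (q - v) ^+ 2 - (u - v) ^+ 2 =
      t^-1 * (t * (u - q) - (q - v)) ^+ 2 by field; rewrite gt_eqF.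
  by rewrite mulr_ge0 ?sqr_ge0// invr_ge0 ltW.
have -> : gap x z = \sum_i \sum_j \sum_k
    m i * mu j * mu k * (g (x, i) - g (z, j)) ^+ 2.
  apply: eq_bigr => i _; apply: eq_bigr => j _.
  rewrite -mulr_suml -mulr_sumr smu mulr1//.
have -> : gap x y = \sum_i \sum_j \sum_k
    m i * mu j * mu k * (g (x, i) - g (y, k)) ^+ 2.
  apply: eq_bigr => i _; rewrite exchange_big/=; apply: eq_bigr => k _.
  rewrite -mulr_suml; congr (_ * _).
  by rewrite -mulr_suml -mulr_sumr smu mulr1.
have -> : gap y z = \sum_i \sum_j \sum_k
    m i * mu j * mu k * (g (y, k) - g (z, j)) ^+ 2.
  under [RHS]eq_bigr => i _ do rewrite exchange_big/=.
  rewrite [RHS]exchange_big/=; apply: eq_bigr => k _.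
  rewrite exchange_big/=; apply: eq_bigr => j _.
  rewrite -mulr_suml; congr (_ * _).
  rewrite -!mulr_suml /mu -[\sum_i m i]/M; field.
  by rewrite gt_eqF.
rewrite !mulr_sumr -big_split/=; apply: ler_sum => i _.
rewrite !mulr_sumr -big_split/=; apply: ler_sum => j _.
rewrite !mulr_sumr -big_split/=; apply: ler_sum => k _.
rewrite (mulrCA (1 + t)) (mulrCA (1 + t^-1)) -mulrDr; apply: ler_wpM2l; last exact: pt.
by apply: mulr_ge0; [apply: mulr_ge0|]; exact: ltW.
Qed.

Local Open Scope ereal_scope.

Definition translation_energy z : \bar R :=
  \esum_(x in [set: G]) (gap x (x * z)%g)%:E.

Lemma translation_energyM (t : R) y z : (0 < t)%R ->
  translation_energy (y * z)%g <=
  (1 + t)%:E * translation_energy y + (1 + t^-1)%:E * translation_energy z.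
Proof.
move=> t0.
have t1 : 0 <= (1 + t)%:E by rewrite lee_fin addr_ge0// ltW.
have t2 : 0 <= (1 + t^-1)%:E by rewrite lee_fin addr_ge0// invr_ge0 ltW.
have -> : translation_energy z =
    \esum_(x in [set: G]) (gap (x * y) (x * (y * z))%g)%:E.
  rewrite /translation_energy (@reindex_esumT _ _ _ (fun x : G => (x * y)%g)).
    by apply: eq_esum => x _; rewrite mulgA.
  by exists (fun x => (x * y^-1)%g) => x; rewrite ?mulgK ?mulgVK.
rewrite -!ge0_esumZl//; [|by move=> x; rewrite lee_fin..].
rewrite -esumD; [|by move=> x _; rewrite mule_ge0 ?lee_fin..].
by apply: le_esum => x _; rewrite -!EFinM -EFinD lee_fin gap_triangle.
Qed.

(** The square root of the translation energy is subadditive, so a word costs the square of its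
    length. The empty word is excluded because its energy need not vanish. *)
Lemma translation_energy_word (A : \bar R) (w : seq G) : 0 <= A ->
  (forall s, s \in S -> translation_energy s <= A) -> {subset w <= S} ->
  (0 < size w)%N ->
  translation_energy (\prod_(s <- w) s)%g <= ((size w)%:R ^+ 2)%:E * A.
Proof.
move=> A0 hA; elim: w => [//|s [|s' w] IHw] wS _.
  by rewrite big_seq1 expr1n mul1e hA// wS// mem_head.
rewrite big_cons; set n := size (s' :: w).
have n0 : (0 < n%:R :> R)%R by rewrite ltr0n.
(* The parameter is $t = n$, the length of the tail: $(1+n) + (1+n^{-1})n^2 = (n+1)^2$. *)
apply: le_trans (translation_energyM _ _ n0) _.
have hw : translation_energy (\prod_(j <- s' :: w) j)%g <= (n%:R ^+ 2)%:E * A.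
  by apply: IHw => // x xw; apply: wS; rewrite inE xw orbT.
have hs := hA s (wS s (mem_head _ _)).
have c1 : 0 <= (1 + n%:R : R)%:E by rewrite lee_fin addr_ge0// ltW.
have c2 : 0 <= (1 + n%:R^-1 : R)%:E by rewrite lee_fin addr_ge0// invr_ge0 ltW.
apply: (le_trans (leeD (lee_wpmul2l c1 hs) (lee_wpmul2l c2 hw))).
rewrite muleA -EFinM -ge0_muleDl// -EFinD.
have -> : (size [:: s, s' & w])%:R = (n%:R + 1 : R)%R by rewrite natr1.
suff -> : (1 + n%:R + (1 + n%:R^-1) * n%:R ^+ 2 = (n%:R + 1) ^+ 2 :> R)%R by [].
by field; rewrite gt_eqF.
Qed.

(** The step $s$ has probability $1/|S|$, so its share of the energy of the walk, times $|S|$, is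
    the translation energy. *)
Lemma translation_energy_gen s : s \in S -> translation_energy s <=
  (#|` S|%:R : R)%:E * energy m (unif_walk S m_gt0 E_gt0) g.
Proof.
move=> sS.
have w0 i : (0 <= m i)%R by exact: ltW.
have cS := card_S_gt0 (R := R) S_neq0.
have t0 (a b : G * E) : 0 <= (m a.2 * (g a - g b) ^+ 2)%:E *
    unif_walk S m_gt0 E_gt0 (a.1^-1 * b.1)%g a.2 b.2.
  by apply: mule_ge0 => //; rewrite lee_fin mulr_ge0 ?sqr_ge0.
have t1 (a : G * E) : 0 <= \esum_(b in [set: G * E])
  ((m a.2 * (g a - g b) ^+ 2)%:E *
    unif_walk S m_gt0 E_gt0 (a.1^-1 * b.1)%g a.2 b.2) by exact: esum_ge0.
rewrite /energy -ge0_esumZl//.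
rewrite esum_pair; last by move=> a; apply: mule_ge0 => //; rewrite lee_fin ltW.
apply: le_esum => x _; rewrite esum_fin; last first.
  by move=> a; apply: mule_ge0 => //; rewrite lee_fin ltW.
rewrite /gap -sumEFin; apply: lee_sum => i _.
rewrite -sumEFin esum_GE; last by move=> b; exact: (t0 (x, i) b).
rewrite ge0_sume_distrr; last first.
  by move=> j _; apply: esum_ge0 => y _; exact: (t0 (x, i) (y, j)).
apply: lee_sum => j _.
pose h y := (m i * (g (x, i) - g (y, j)) ^+ 2)%:E *
  unif_walk S m_gt0 E_gt0 (x^-1 * y)%g i j.
have hs : h (x * s)%g <= \esum_(y in [set: G]) h y.
  by apply: esum_ub1 => y; exact: (t0 (x, i) (y, j)).
apply: le_trans (lee_wpmul2l _ hs); last by rewrite lee_fin ltW.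
rewrite /h /= mulKg /unif_prob sS mul1r -!EFinM lee_fin le_eqVlt; apply/orP; left.
by apply/eqP; rewrite /mu -/M; field; rewrite !gt_eqF//.
Qed.

Lemma translation_energy_le z : translation_energy z <=
  ((word_dist R S 1%g z ^+ 2 + 4) * #|` S|%:R)%:E *
  energy m (unif_walk S m_gt0 E_gt0) g.
Proof.
set en := energy _ _ _; have en0 : 0 <= en by exact: energy_ge0.
set A := (#|` S|%:R : R)%:E * en.
have A0 : 0 <= A by apply: mule_ge0 => //; rewrite lee_fin.
have [s sS] : exists s, s \in S by exact/fset0Pn.
have [w [wS wz] ->] := word_dist_attained (R := R) S_sym S_gen z.
rewrite EFinM -muleA -/A.
have [w0|w0] := posnP (size w); last first.
  rewrite -wz; apply: le_trans (translation_energy_word A0 _ wS w0) _.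
    exact: translation_energy_gen.
  by rewrite lee_wpmul2r// lee_fin lerDl.
(* The neutral element is written as a word of length 2, which is where the summand $4 = 2^2$ comes
   from. *)
have -> : z = (\prod_(x <- [:: s; s^-1]) x)%g.
  by rewrite -wz (size0nil w0) big_nil big_cons big_seq1 mulgV.
apply: le_trans (translation_energy_word A0 _ _ _) _ => //.
- exact: translation_energy_gen.
- by move=> x; rewrite !inE => /orP[/eqP ->//|/eqP ->]; exact: S_sym.
- by rewrite lee_wpmul2r// lee_fin w0 /=; lra.
Qed.

(** Sort the energy by the increment $z$. Since $m_j \ge c$, each pair $(i,j)$ contributes at most
    $M/c$ times the translation energy of $z$, which is quadratic in its length. Summing against $p$
    yields the second moment, and $4|E|$ from the summand 4. *)
Lemma energy_second_moment (p : G * E -> G * E -> R) (p_mk : markov_kernel p)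
    (c : R) : (0 < c)%R -> (forall i, c <= m i)%R ->
  energy m (nker_of p_mk) g <=
  (M / c * #|` S|%:R)%:E * (second_moment S p + (4 * #|E|%:R)%:E) *
  energy m (unif_walk S m_gt0 E_gt0) g.
Proof.
move=> c0 cm.
have en0 : 0 <= energy m (unif_walk S m_gt0 E_gt0) g by exact: energy_ge0.
have en_ge := translation_energy_le; move: en_ge en0.
move: (energy m (unif_walk S m_gt0 E_gt0) g) => en en_ge en0.
pose P := nker_of p_mk; have sP : stochastic P := stochastic_nker_of p_mk.
have Mc0 : (0 < M / c)%R by rewrite divr_gt0.
have t0 (a b : G * E) : 0 <= (m a.2 * (g a - g b) ^+ 2)%:E.
  by rewrite lee_fin mulr_ge0 ?sqr_ge0// ltW.
have -> : energy m P g = \sum_i \sum_j \esum_(z in [set: G])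
    (P z i j * \esum_(x in [set: G]) (m i * (g (x, i) - g ((x * z)%g, j)) ^+ 2)%:E).
  have tP (a b : G * E) : 0 <= (m a.2 * (g a - g b) ^+ 2)%:E *
    P (a.1^-1 * b.1)%g a.2 b.2 by exact: mule_ge0.
  rewrite /energy esum_GE; last by move=> a; exact: esum_ge0.
  apply: eq_bigr => i _.
  transitivity (\esum_(x in [set: G]) \sum_j \esum_(z in [set: G])
     (P z i j * (m i * (g (x, i) - g ((x * z)%g, j)) ^+ 2)%:E)).
    apply: eq_esum => x _; rewrite (esum_mulg x) esum_GE/=; last first.
      by move=> b; exact: (tP (x, i) ((x * b.1)%g, b.2)).
    apply: eq_bigr => j _; apply: eq_esum => z _.
    by rewrite mulKg muleC.
  have tz x j z : 0 <= P z i j * (m i * (g (x, i) - g ((x * z)%g, j)) ^+ 2)%:E.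
    by apply: mule_ge0 => //; exact: (t0 (x, i) _).
  rewrite esum_sum; last by move=> *; exact: esum_ge0.
  apply: eq_bigr => j _; rewrite exchange_esum//; apply: eq_esum => z _.
  by rewrite ge0_esumZl// => x; exact: (t0 (x, i) _).
pose D z := (word_dist R S 1%g z ^+ 2)%R.
have D0 z : (0 <= D z)%R by exact: sqr_ge0.
have key z i j : \esum_(x in [set: G])
    (m i * (g (x, i) - g ((x * z)%g, j)) ^+ 2)%:E <=
    (M / c * ((D z + 4) * #|` S|%:R))%:E * en.
  rewrite EFinM -muleA.
  apply: le_trans (lee_wpmul2l _ (en_ge z)); last first.
    by rewrite lee_fin ltW.
  rewrite -ge0_esumZl; [|by rewrite lee_fin ltW|by move=> x; rewrite lee_fin].
  apply: le_esum => x _; rewrite -EFinM lee_fin.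
  have tt i' j' : (0 <= m i' * mu j' * (g (x, i') - g ((x * z)%g, j')) ^+ 2)%R.
    by apply: mulr_ge0; [apply: mulr_ge0; exact: ltW|exact: sqr_ge0].
  rewrite /gap (bigD1 i)//= (bigD1 j)//= -addrA mulrDr -[leLHS]addr0 lerD//.
    rewrite [leRHS]mulrA; apply: ler_wpM2r; first exact: sqr_ge0.
    rewrite (_ : M / c * (m i * mu j) = m i * (m j / c))%R; last first.
      by rewrite /mu; field; rewrite !gt_eqF.
    by rewrite ler_peMr ?ler_pdivlMr ?mul1r// ltW.
  apply: mulr_ge0; first exact: ltW.
  apply: addr_ge0; apply: sumr_ge0 => i' _; first exact: tt.
  by apply: sumr_ge0 => j' _; exact: tt.
apply: (@le_trans _ _ (\sum_i \sum_j \esum_(z in [set: G])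
    (P z i j * ((M / c * ((D z + 4) * #|` S|%:R))%:E * en)))).
  apply: lee_sum => i _; apply: lee_sum => j _; apply: le_esum => z _.
  by apply: lee_wpmul2l.
have -> : \sum_i \sum_j \esum_(z in [set: G])
    (P z i j * ((M / c * ((D z + 4) * #|` S|%:R))%:E * en)) =
  \sum_i \sum_j ((M / c * #|` S|%:R)%:E *
    (\esum_(z in [set: G]) (D z * p (1%g, i) (z, j))%:E +
     4%:E * \esum_(z in [set: G]) P z i j) * en).
  apply: eq_bigr => i _; apply: eq_bigr => j _.
  have k0 : 0 <= (M / c * #|` S|%:R)%:E by rewrite lee_fin mulr_ge0// ltW.
  have p0 z : (0 <= p (1%g, i) (z, j))%R by have [+ _] := p_mk; apply.
  have d0 z : 0 <= (D z * p (1%g, i) (z, j))%:E by rewrite lee_fin mulr_ge0.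
  rewrite -(@ge0_esumZl _ _ 4%:E)// -esumD//; last by move=> z _; exact: mule_ge0.
  have s0 z : 0 <= (D z * p (1%g, i) (z, j))%:E + 4%:E * P z i j.
    by apply: adde_ge0 => //; exact: mule_ge0.
  rewrite -ge0_esumZl// -ge0_esumZr//; last by move=> z; exact: mule_ge0.
  apply: eq_esum => z _; rewrite muleA; congr (_ * _).
  by rewrite /= -!EFinM; congr EFin; ring.
set K := (M / c * #|` S|%:R)%:E.
pose W i j := \esum_(z in [set: G]) (D z * p (1%g, i) (z, j))%:E.
pose V i j := \esum_(z in [set: G]) P z i j.
have K0 : 0 <= K by rewrite lee_fin mulr_ge0// ltW.
have W0 i j : 0 <= W i j.
  by apply: esum_ge0 => z _; rewrite lee_fin mulr_ge0//; have [+ _] := p_mk; apply.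
have V0 i j : 0 <= V i j by exact: esum_ge0.
have V4 i j : 0 <= 4%:E * V i j by exact: mule_ge0.
have WV0 i j : 0 <= W i j + 4%:E * V i j by exact: adde_ge0.
have sumV : \sum_i \sum_j V i j = (#|E|%:R : R)%:E.
  rewrite (eq_bigr (fun _ => 1)).
    by rewrite sumEFin big_const iter_addr addr0.
  by move=> i _; rewrite -(sP i) esum_GE.
have dist k (f : E -> E -> \bar R) : 0 <= k -> (forall i j, 0 <= f i j) ->
    k * (\sum_i \sum_j f i j) = \sum_i \sum_j (k * f i j).
  move=> k0 f0; rewrite ge0_sume_distrr; last by move=> i _; exact: sume_ge0.
  by apply: eq_bigr => i _; rewrite ge0_sume_distrr.
have -> : second_moment S p + (4 * #|E|%:R)%:E =
    \sum_i \sum_j (W i j + 4%:E * V i j).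
  rewrite EFinM -sumV dist// -big_split/=.
  by apply: eq_bigr => i _; rewrite -big_split.
rewrite muleC dist// dist//; last by move=> i j; exact: mule_ge0.
rewrite le_eqVlt; apply/orP; left; apply/eqP.
by apply: eq_bigr => i _; apply: eq_bigr => j _; rewrite muleC.
Qed.

End EnergyComparison.

(** * Bounds for a fixed parameter *)

Section FixedParameter.
Context {R : realType} {G : groupType} {E : finType}.
Variables (S : {fset G}) (m : E -> R).
Hypothesis S_sym : symmetric_fset S.
Hypothesis S_neq0 : S != fset0.
Hypothesis m_gt0 : forall i, 0 < m i.
Hypothesis E_gt0 : (0 < #|E|)%N.
Variable P : nker R G E.
Hypothesis sP : stochastic P.
Hypothesis PP : adjoint m P P.

Let B := unif_walk S m_gt0 E_gt0.
Let sB : stochastic B := stochastic_unif_walk S_neq0 m_gt0 E_gt0.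
Let BB : adjoint m B B := adjoint_unif_walk S_sym m_gt0 E_gt0.
Let u := conv_pow (unif_prob R S).
Let E0 : 0 < #|E|%:R :> R. Proof. by rewrite ltr0n. Qed.

(** Write $X^j = X^l X^{j-2l} X^l$ and use that the middle factor is a contraction of $\ell^2(m)$;
    $j$ may be odd. *)
Lemma tr_even_le (X : nker R G E) j l : stochastic X -> adjoint m X X -> (2 * l <= j)%N ->
  tr (X ^+ j) <= tr (X ^+ (2 * l)).
Proof.
move=> sX XX lj.
have sXn n : stochastic (X ^+ n) by exact: stochasticX.
have XXn n : adjoint m (X ^+ n) (X ^+ n) by exact: adjointX.
have -> : X ^+ j = X ^+ l * X ^+ (j - 2 * l) * X ^+ l.
  by rewrite -!exprD; congr (_ ^+ _); lia.
have -> : X ^+ (2 * l) = X ^+ l * X ^+ l by rewrite -exprD addnn mul2n.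
exact: tr_contract.
Qed.

Lemma return_upper_bound (eps e : R) K n : e = eps ^+ 2 / K.+1%:R / 48 ->
  0 < eps -> eps <= 1 ->
  (forall x i j, x \in S -> (eps%:E <= (P ^+ K)%R x i j)%E) ->
  #|E|%:R^-1 * tr (P ^+ (2 * n + 2)) <=
  2 * (1 - e) ^+ (2 * n) + 2 / #|E|%:R * u (2 * Num.truncn (e * n%:R)) 1%g.
Proof.
set d := eps ^+ 2 / K.+1%:R => eE e0 e1 hP.
have d0 : 0 < d by rewrite divr_gt0 ?exprn_gt0.
have d1 : d <= 1.
  rewrite ler_pdivrMr// mul1r (@le_trans _ _ 1)// ?ler1n//.
  by rewrite expr_le1// ltW.
have [k [kn nk]] := pow2_between n.
set l := Num.truncn _.
have le_en : l%:R <= e * n%:R.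
  by rewrite truncn_le// mulr_ge0// eE divr_ge0// ltW.
(* The trace of $B^0$ is $|E|$, whereas $\mu_S^{(0)}(e) = 1$. The threshold is therefore kept
   positive, at the price $2^J \le 2 \cdot 2^l$. *)
pose J := maxn l 1.
have hPB := unif_walk_le S_neq0 m_gt0 E_gt0 (ltW e0) hP.
have h1 : tr (P ^+ (2 * n + 2)) <= tr (P ^+ (2 * 2 ^ k)).
  by apply: tr_even_le => //; lia.
have h2 := tr_irreducible_le m_gt0 k e0 e1 sP PP sB BB hPB.
have sB2 : stochastic (B ^+ 2) by exact: stochasticX.
have uJ : u (2 * J)%N 1%g <= u (2 * l)%N 1%g.
  rewrite /J; case: (l) => [|l']; last by rewrite (maxn_idPl _).
  by rewrite muln0 [X in _ <= X]/u /= eqxx; exact: (conv_pow_le1 S_neq0 m_gt0 E_gt0).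
have trJ : tr (B ^+ (2 * J)) = u (2 * J)%N 1%g.
  have [j ->] : exists j, (2 * J = j.+1)%N.
    by exists (2 * J).-1; rewrite prednK// muln_gt0 leq_max orbT.
  exact: tr_unif_walk.
have h3 := @tr_chernoff _ _ _ d #|E|%:R (u (2 * J)%N 1%g) J (B ^+ 2) _ sB2.
have {}h3 := h3 _ _ _ _ _ (2 ^ k)%N 0%N.
rewrite !expr0 mul1r mulr1 in h3.
have {}h3 : tr (mix d 1 (B ^+ 2) ^+ (2 ^ k)) <=
    #|E|%:R * 2 ^+ J * (1 - d / 2) ^+ (2 ^ k) + u (2 * J)%N 1%g.
  apply: h3.
  - by rewrite (ltW d0) d1.
  - exact: ltW.
  - by apply: conv_pow_ge0.
  - by move=> j; apply: tr_le; exact: stochasticX.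
  - move=> j Jj; rewrite -exprM -trJ; apply: tr_even_le => //.
    by rewrite leq_mul2l Jj orbT.
have h4 : 2 ^+ l * (1 - d / 2) ^+ (2 ^ k) <= (1 - e) ^+ (2 * n).
  rewrite eE; apply: two_exp_decay => //; apply: (le_trans le_en).
  have : 0 <= d / 48 * n%:R by rewrite mulr_ge0// divr_ge0// ltW.
  by rewrite eE; lra.
have h5 : 2 ^+ J <= 2 * 2 ^+ l :> R.
  have Jl : (J <= l.+1)%N by rewrite /J geq_max leqnSn.
  by rewrite -exprS ler_weXn2l ?ler1n.
have b0 : 0 <= (1 - d / 2) ^+ (2 ^ k) by rewrite exprn_ge0//; lra.
have ul0 : 0 <= u (2 * l)%N 1%g by exact: conv_pow_ge0.
rewrite mulrC ler_pdivrMr// mulrDl (mulrAC (2 / _)) divfK ?gt_eqF//.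
have h6 : 2 ^+ J * (1 - d / 2) ^+ (2 ^ k) <= 2 * (1 - e) ^+ (2 * n).
  by apply: le_trans (ler_wpM2r b0 h5) _; rewrite -mulrA ler_wpM2l.
have h7 : #|E|%:R * (2 ^+ J * (1 - d / 2) ^+ (2 ^ k)) <=
    #|E|%:R * (2 * (1 - e) ^+ (2 * n)) by rewrite ler_wpM2l// ltW.
rewrite mulrA in h7.
lra.
Qed.

(** For the lazy kernel $L = (I+B)/2$, $I - L^2 \ge (I-B)/2 \ge (t/2)(I-P)$, hence $d = t/2$.
    Laziness also halves the left-hand side, hence the factors 2 on the right. *)
Lemma return_lower_bound (t e : R) n : e = t / 2 / 48 -> 0 < t -> t <= 1 ->
  (forall g, (forall a, 0 <= g a) ->
    (t%:E * energy m P g <= energy m B g)%E) ->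
  #|E|%:R^-1 * u (2 * n + 2)%N 1%g <=
  2 * (1 - e) ^+ (2 * n) + 2 / #|E|%:R * tr (P ^+ (2 * Num.truncn (e * n%:R))).
Proof.
set d := t / 2 => eE t0 t1 hPB.
have d0 : 0 < d by rewrite divr_gt0.
have d1 : d <= 1 by rewrite /d; lra.
have [k [kn nk]] := pow2_between n.
set l := Num.truncn _.
have le_en : l%:R <= e * n%:R.
  by rewrite truncn_le// mulr_ge0// eE divr_ge0// ltW.
have uE : u (2 * n + 2)%N 1%g = tr (B ^+ (2 * n + 2)).
  have [j ->] : exists j, (2 * n + 2 = j.+1)%N by exists (2 * n).+1; lia.
  by symmetry; exact: tr_unif_walk.
(* Since $2 \cdot 2^k \le 2n+2$, every even time reached has trace at least that at time $2n+2$. *)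
have h1 : 2^-1 * u (2 * n + 2)%N 1%g <= tr (mix 2^-1 1 B ^+ (2 * 2 ^ k)).
  have [j jE] : exists j, (2 * 2 ^ k = j.+1)%N.
    by exists (2 * 2 ^ k).-1; rewrite prednK// muln_gt0 expn_gt0.
  have := @tr_half_ge _ _ _ (u (2 * n + 2)%N 1%g) (2 * n + 2)%N B sB _ j 0%N.
  rewrite expr0 mul1r -jE; apply; last by lia.
  move=> i oi ni; rewrite uE.
  have -> : (i = 2 * i./2)%N by rewrite mul2n; lia.
  by apply: tr_even_le => //; lia.
have t01 : 0 <= t <= 1 by rewrite (ltW t0) t1.
have h2 := tr_lazy_le m_gt0 k t01 sP PP sB BB hPB.
have h3 : tr (mix d 1 P ^+ (2 ^ k)) <=
    #|E|%:R * 2 ^+ (2 * l) * (1 - d / 2) ^+ (2 ^ k) + tr (P ^+ (2 * l)).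
  have := @tr_chernoff _ _ _ d #|E|%:R (tr (P ^+ (2 * l))) (2 * l)%N P _ sP _ _ _ _
    (2 ^ k)%N 0%N.
  rewrite !expr0 mul1r mulr1; apply.
  - by rewrite (ltW d0) d1.
  - exact: ltW.
  - exact: tr_ge0.
  - by move=> j; apply: tr_le; exact: stochasticX.
  - by move=> j; exact: tr_even_le.
have h4 : 2 ^+ (2 * l) * (1 - d / 2) ^+ (2 ^ k) <= (1 - e) ^+ (2 * n).
  by rewrite eE; apply: two_exp_decay; rewrite -?eE// natrM -mulrA ler_wpM2l.
rewrite mulrC ler_pdivrMr// mulrDl (mulrAC (2 / _)) divfK ?gt_eqF//.
have h7 : #|E|%:R * (2 ^+ (2 * l) * (1 - d / 2) ^+ (2 ^ k)) <=
    #|E|%:R * (1 - e) ^+ (2 * n) by rewrite ler_wpM2l// ltW.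
rewrite mulrA in h7.
lra.
Qed.

End FixedParameter.

(** * Dependence on the parameter *)

Section WithinContinuity.
Context {R : realType}.
Variable I : set R.
Implicit Types f g : R -> R.

Lemma within_continuousM f g : {within I, continuous f} ->
  {within I, continuous g} -> {within I, continuous (fun r => f r * g r)}.
Proof.
move=> /subspace_continuousP cf /subspace_continuousP cg.
apply/subspace_continuousP => r Ir.
by apply: cvgM; [exact: cf|exact: cg].
Qed.

Lemma within_continuousD f g : {within I, continuous f} ->
  {within I, continuous g} -> {within I, continuous (fun r => f r + g r)}.
Proof.
move=> /subspace_continuousP cf /subspace_continuousP cg.
apply/subspace_continuousP => r Ir.
by apply: cvgD; [exact: cf|exact: cg].
Qed.

Lemma within_continuousV f : (forall r, I r -> f r != 0) ->
  {within I, continuous f} -> {within I, continuous (fun r => (f r)^-1)}.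
Proof.
move=> f0 /subspace_continuousP cf.
apply/subspace_continuousP => r Ir.
by apply: cvgV; [exact: f0|exact: cf].
Qed.

Lemma within_continuous_cst (k : R) : {within I, continuous (fun _ => k)}.
Proof. by apply/subspace_continuousP => r Ir; exact: cvg_cst. Qed.

End WithinContinuity.

Unset Implicit Arguments.
Set Strict Implicit.

Theorem proposition3p12 (R : realType) (G : groupType) (E : finType)
    (I : set R) (p : R -> G * E -> G * E -> R) (S : {fset G})
    (G_amenable : amenable R G)
    (E_nonempty : (0 < #|E|)%N)
    (I_interval : is_interval I)
    (p_family : continuous_kernel_family I p)
    (S_nonempty : S != fset0)
    (S_symmetric : symmetric_fset S)
    (S_generates : generates S)
    (p_invariant : invariant_family I p)
    (p_reversible : strongly_reversible I p)
    (p_irreducible : uniformly_irreducible S I p) :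
  (exists eps : R -> R,
    [/\ {within I, continuous eps},
        forall r, I r -> 0 < eps r < 2^-1
      & forall (n : nat) (r : R), I r ->
          #|E|%:R^-1 *
            (\sum_(i : E) kernel_pow (p r) (2 * n + 2) (1%g, i) (1%g, i))
          <= 2 * (1 - eps r) ^+ (2 * n)
             + 2 / #|E|%:R *
               conv_pow (unif_prob R S) (2 * Num.truncn (eps r * n%:R)) 1%g]) /\
  (continuous_second_moment S I p ->
   exists eps' : R -> R,
    [/\ {within I, continuous eps'},
        forall r, I r -> 0 < eps' r < 2^-1
      & forall (n : nat) (r : R), I r ->
          #|E|%:R^-1 * conv_pow (unif_prob R S) (2 * n + 2) 1%g
          <= 2 * (1 - eps' r) ^+ (2 * n)
             + 2 / #|E|%:R *
               (\sum_(i : E) kernel_pow (p r)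
                  (2 * Num.truncn (eps' r * n%:R)) (1%g, i) (1%g, i))]).
Proof.
have [p_mk _] := p_family.
have [w [_ _ w_rev [c [C [c_cont C_cont cC_gt0 w_bound]]]]] := p_reversible.
have [K [eps [eps_cont eps_gt0 p_irr]]] := p_irreducible.
have [s sS] : exists s, s \in S by exact/fset0Pn.
have /card_gt0P[i0 _] := E_nonempty.
have E_ge1 : 1 <= #|E|%:R :> R by rewrite ler1n.
have S_ge1 : 1 <= #|` S|%:R :> R.
  by rewrite ler1n -(ltr0n R) card_S_gt0.
pose m r (i : E) := w r (1%g, i).
have m_gt0 r : I r -> forall i, 0 < m r i.
  move=> Ir i; have [c0 _] := cC_gt0 r Ir.
  by have /andP[cw _] := w_bound r Ir (1%g, i); exact: lt_le_trans cw.
have P_adj r (Ir : I r) :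
    adjoint (m r) (nker_of (p_mk r Ir)) (nker_of (p_mk r Ir)).
  have [c0 _] := cC_gt0 r Ir.
  exact: (adjoint_nker_of S_generates (p_mk r Ir) (p_invariant r Ir) (w_rev r Ir)
    c0 (w_bound r Ir) (eps_gt0 r Ir) (p_irr r Ir)).
have P_sto r (Ir : I r) := stochastic_nker_of (p_mk r Ir).
split.
  have P_irr r (Ir : I r) x i j : x \in S ->
      ((eps r)%:E <= (nker_of (p_mk r Ir) ^+ K)%R x i j)%E.
    move=> xS; have := kernel_powE (p_mk r Ir) (p_invariant r Ir) K (1%g, i) (x, j).
    rewrite /= invg1 mul1g => <-; rewrite lee_fin.
    by apply: p_irr => //; rewrite invg1 mul1g.
  (* The function [eps] bounds a transition probability from below; a point of [S] and one of [E]
     provide an instance. *)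
  have eps_le1 r (Ir : I r) : eps r <= 1.
    rewrite -lee_fin (le_trans (P_irr r Ir s i0 i0 sS))//.
    exact: stochastic_le1 (stochasticX _ (P_sto r Ir)).
  (* The comparison constant of [tr_irreducible_le], divided by the 48 of [two_exp_decay]. *)
  exists (fun r => eps r ^+ 2 / K.+1%:R / 48); split.
  - apply: within_continuousM; last exact: within_continuous_cst.
    apply: within_continuousM; last exact: within_continuous_cst.
    by apply: within_continuousM.
  - move=> r Ir; have e0 := eps_gt0 r Ir; have e1 := eps_le1 r Ir.
    have d0 : 0 < eps r ^+ 2 / K.+1%:R by rewrite divr_gt0// exprn_gt0.
    have d1 : eps r ^+ 2 / K.+1%:R <= 1.
      rewrite ler_pdivrMr// mul1r (@le_trans _ _ 1)// ?ler1n//.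
      by rewrite expr_le1// ltW.
    move: (eps r ^+ 2 / _) d0 d1 => d d0 d1.
    by apply/andP; split; lra.
  - move=> n r Ir; rewrite (sum_kernel_pow (p_mk r Ir) (p_invariant r Ir)).
    exact: (return_upper_bound S_symmetric S_nonempty (m_gt0 r Ir) E_nonempty
      (P_sto r Ir) (P_adj r Ir) n erefl (eps_gt0 r Ir) (eps_le1 r Ir) (P_irr r Ir)).
move=> [M2_fin M2_cont].
pose v r := fine (second_moment S (p r)).
have v_ge0 r : I r -> 0 <= v r.
  move=> Ir; apply: fine_ge0; do 2!apply: sume_ge0 => ? _.
  apply: esum_ge0 => x _; rewrite lee_fin mulr_ge0 ?sqr_ge0//.
  by have [+ _] := p_mk r Ir; apply.
(* The constant of [energy_second_moment], with the total mass bounded by $|E|\,C(r)$. It is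
   continuous and at least 1, so $t = 1/A(r)$ is admissible in [return_lower_bound]. *)
pose A r := #|E|%:R * C r / c r * #|` S|%:R * (v r + 4 * #|E|%:R).
have A_ge1 r : I r -> 1 <= A r.
  move=> Ir; have [c0 C0] := cC_gt0 r Ir.
  have /andP[cw wC] := w_bound r Ir (1%g, i0).
  have Cc : 1 <= C r / c r by rewrite ler_pdivlMr// mul1r (le_trans cw).
  apply: mulr_ege1; last by have := v_ge0 r Ir; lra.
  by apply: mulr_ege1 => //; rewrite -mulrA; exact: mulr_ege1.
exists (fun r => (A r)^-1 / 2 / 48); split.
- apply: within_continuousM; last exact: within_continuous_cst.
  apply: within_continuousM; last exact: within_continuous_cst.
  apply: within_continuousV.
    by move=> r Ir; rewrite gt_eqF// (lt_le_trans _ (A_ge1 r Ir)).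
  apply: within_continuousM.
    apply: within_continuousM; last exact: within_continuous_cst.
    apply: within_continuousM.
      by apply: within_continuousM => //; exact: within_continuous_cst.
    apply: within_continuousV => // r Ir.
    by have [c0 _] := cC_gt0 r Ir; rewrite gt_eqF.
  by apply: within_continuousD => //; exact: within_continuous_cst.
- move=> r Ir; have A1 := A_ge1 r Ir.
  have A0 : 0 < A r by rewrite (lt_le_trans _ A1).
  have i1 : (A r)^-1 <= 1 by rewrite invf_le1.
  have i2 : 0 < (A r)^-1 by rewrite invr_gt0.
  move: ((A r)^-1) i1 i2 => d i1 i2.
  by apply/andP; split; lra.
- move=> n r Ir; rewrite (sum_kernel_pow (p_mk r Ir) (p_invariant r Ir)).
  have A1 := A_ge1 r Ir.
  have A0 : 0 < A r by rewrite (lt_le_trans _ A1).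
  have [c0 C0] := cC_gt0 r Ir.
  have i1 : (A r)^-1 <= 1 by rewrite invf_le1.
  have i0' : 0 < (A r)^-1 by rewrite invr_gt0.
  apply: (@return_lower_bound _ _ _ S _ S_symmetric S_nonempty (m_gt0 r Ir)
    E_nonempty _ (P_sto r Ir) (P_adj r Ir) _ _ n erefl i0' i1) => g g0.
  have cm i : c r <= m r i by have /andP[] := w_bound r Ir (1%g, i).
  have := energy_second_moment S_symmetric S_nonempty S_generates (m_gt0 r Ir)
    E_nonempty g (p_mk r Ir) c0 cm.
  rewrite -(fineK (M2_fin r Ir)) -/(v r) -EFinD -EFinM => hen.
  have massC : mass (m r) <= #|E|%:R * C r.
    rewrite /mass (le_trans (ler_sum _ (fun i _ => (andP (w_bound r Ir (1%g, i))).2)))//.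
    by rewrite big_const iter_addr addr0 mulr_natl.
  set en := energy _ (unif_walk _ _ _) _ in hen *.
  have en0 : (0 <= en)%E by exact: (energy_ge0 (m_gt0 r Ir)).
  have hA : (energy (m r) (nker_of (p_mk r Ir)) g <= (A r)%:E * en)%E.
    apply: (le_trans hen); apply: lee_wpmul2r => //; rewrite lee_fin /A.
    rewrite ler_wpM2r//; first by have := v_ge0 r Ir; lra.
    rewrite ler_wpM2r// ler_wpM2r// ?invr_ge0 ltW//.
  apply: (@le_trans _ _ ((A r)^-1%:E * ((A r)%:E * en))%E).
    by apply: lee_wpmul2l => //; rewrite lee_fin invr_ge0 ltW.
  by rewrite muleA -EFinM mulVf ?gt_eqF// mul1e.
Qed.
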